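(* Let $B$ and $D$ be two unital $C^*$-algebras, $A=B\otimes_{\max}D$ and $A_0=B\otimes_{\min}D$. (a) If $B$ has strong property $(T)$ and $D$ has property $(T)$ (respectively, strong property $(T)$), then $A$ has property $(T)$ (respectively, strong property $(T)$). (b) If there is no almost central unit vector for $D$ in any unital Hilbert bimodule over $D$, then $A$ has strong property $(T)$. (c) Suppose that there exists an almost central unit vector $(\eta_j)_{j\in J}$ for $D$ in some unital Hilbert bimodule $K$ over $D$. If $A_0$ has property $(T)$ (respectively, strong property $(T)$), then so does $B$. (d) If $A_0$ has property $(T)$ (respectively, strong property $(T)$), then either $B$ or $D$ has property $(T)$ (respectively, strong property $(T)$).
   Context: Let $E$ be a unital $C^*$-algebra. A unital Hilbert bimodule over $E$ is a Hilbert space $H$ with commuting unital left and right actions of $E$ coming from a non-degenerate $*$-representation of $E\otimes_{\max}E^{\rm op}$, with $(a\otimes b^{\rm op})\xi=a\cdot\xi\cdot b$ ($E^{\rm op}$ is the opposite $C^*$-algebra). For such $H$, $H^E:=\{\xi\in H: a\cdot\xi=\xi\cdot a\text{ for all }a\in E\}$ and $P^E_H:H\to H^E$ is the orthogonal projection. For a non-empty finite $Q\subseteq E$ and $\beta>0$, $V_H(Q,\beta):=\{\xi\in H:\|\xi\|=1,\ \|x\cdot\xi-\xi\cdot x\|<\beta\text{ for all }x\in Q\}$. An almost central unit vector for $E$ in $H$ is a net $(\xi_i)_{i\in I}$ of unit vectors of $H$ with $\|a\cdot\xi_i-\xi_i\cdot a\|\to 0$ for every $a\in E$. $E$ has property $(T)$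 if there exist a non-empty finite $F\subseteq E$ and $\epsilon>0$ such that for any unital Hilbert bimodule $H$ over $E$, $V_H(F,\epsilon)\neq\emptyset$ implies $H^E\neq\{0\}$. $E$ has strong property $(T)$ if for any $\alpha>0$ there exist a non-empty finite $Q\subseteq E$ and $\beta>0$ such that for any unital Hilbert bimodule $H$ over $E$ and any $\xi\in V_H(Q,\beta)$, $\|\xi-P^E_H(\xi)\|<\alpha$. *)

(* Defs.v *)
From HB Require Import structures.
From mathcomp Require Import all_boot all_order all_algebra.
From mathcomp Require Import complex.
From mathcomp Require Import all_classical all_reals all_analysis.

Set Implicit Arguments.
Unset Strict Implicit.
Unset Printing Implicit Defensive.

Import Order.TTheory GRing.Theory Num.Theory.
Import numFieldNormedType.Exports.

Local Open Scope classical_set_scope.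
Local Open Scope complex_scope.
Local Open Scope ring_scope.

(* The norm of a normed module over R[i] has values in R[i]; it is a
   nonnegative real there, and for r : R the inequality `|x| < r%:C is the
   usual one between real numbers. The inner product is linear in its first
   argument. *)
HB.mixin Record isHilbert (R : realType) H of CompleteNormedModule R[i] H := {
  inner : {dot H for @Num.conj R[i]};
  inner_norm : forall x : H, inner x x = `|x| ^+ 2 }.

#[short(type="hilbertType")]
HB.structure Definition Hilbert (R : realType) :=
  { H of isHilbert R H & CompleteNormedModule R[i] H }.

(* Unital C*-algebras. Hierarchy-Builder admits no common extension of
   GRing.Algebra and NormedModule (a ring with a norm has to be a numDomain),
   so the (real-valued) norm cnorm and its completeness are part of the mixin. *)
HB.mixin Record isCstarAlgebra (R : realType) A of GRing.Algebra R[i] A := {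
  star : A -> A;
  cnorm : A -> R;
  starK : involutive star;
  starD : forall x y : A, star (x + y) = star x + star y;
  starZ : forall (k : R[i]) (x : A), star (k *: x) = Num.conj k *: star x;
  starM : forall x y : A, star (x * y) = star y * star x;
  cnormD : forall x y : A, cnorm (x + y) <= cnorm x + cnorm y;
  cnormZ : forall (k : R[i]) (x : A), (cnorm (k *: x))%:C = `|k| * (cnorm x)%:C;
  cnorm0_eq0 : forall x : A, cnorm x = 0 -> x = 0;
  cnormM : forall x y : A, cnorm (x * y) <= cnorm x * cnorm y;
  cnorm_star : forall x : A, cnorm (star x * x) = cnorm x ^+ 2;
  cnorm_complete : forall u : nat -> A,
    (forall e : R, 0 < e -> exists N : nat, forall m n : nat,
       (N <= m)%N -> (N <= n)%N -> cnorm (u m - u n) < e) ->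
    exists l : A, forall e : R, 0 < e -> exists N : nat, forall n : nat,
       (N <= n)%N -> cnorm (u n - l) < e }.

#[short(type="cstarType")]
HB.structure Definition CstarAlgebra (R : realType) :=
  { A of isCstarAlgebra R A & GRing.Algebra R[i] A }.

(* The opposite C*-algebra: E^c, the library's converse ring of E, with the
   same linear structure, involution and norm as E. *)
Section Opposite.
Variables (R : realType) (E : cstarType R).
Local Notation Eop := (E^c)%type.

HB.instance Definition _ := GRing.Lmodule.copy Eop E.

Fact op_scalerAl (k : R[i]) (x y : Eop) :
  k *: (x * y : Eop) = ((k *: x : Eop) * y : Eop).
Proof. exact: (@scalerAr R[i] E k y x). Qed.

HB.instance Definition _ := GRing.Lmodule_isLalgebra.Build R[i] Eop op_scalerAl.

Fact op_scalerAr (k : R[i]) (x y : Eop) : k *: (x * y) = x * (k *: y).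
Proof. exact: (@scalerAl R[i] E k y x). Qed.

HB.instance Definition _ := GRing.Lalgebra_isAlgebra.Build R[i] Eop op_scalerAr.

Let ostar : Eop -> Eop := @star R E.
Let onorm : Eop -> R := @cnorm R E.

Fact op_starM (x y : Eop) : ostar (x * y) = ostar y * ostar x.
Proof. exact: (@starM R E y x). Qed.

Fact op_cnormM (x y : Eop) : onorm (x * y) <= onorm x * onorm y.
Proof. by rewrite [leRHS]mulrC; exact: (@cnormM R E y x). Qed.

Fact cnorm_ge0 (x : E) : 0 <= cnorm x.
Proof.
have n0 : cnorm (0 : E) = 0.
  have := @cnormZ R E 0 0; rewrite scaler0 normr0 mul0r.
  by move=> /(congr1 (@complex.Re R)).
have nN : cnorm (- x) = cnorm x.
  have := @cnormZ R E (-1) x; rewrite scaleN1r normrN normr1 mul1r.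
  by move=> /(congr1 (@complex.Re R)).
have := cnormD x (- x); rewrite subrr n0 nN -mulr2n.
by rewrite pmulrn_lge0.
Qed.

Fact cnorm_starE (x : E) : cnorm (star x) = cnorm x.
Proof.
have le y : cnorm y <= cnorm (star y :> E).
  have [->|y0] := eqVneq (cnorm y) 0; first exact: cnorm_ge0.
  have yp : 0 < cnorm y by rewrite lt_neqAle eq_sym y0 cnorm_ge0.
  by rewrite -(ler_pM2r yp) -expr2 -cnorm_star cnormM.
by apply/eqP; rewrite eq_le le -{2}(starK x) le.
Qed.

Fact op_cnorm_star (x : Eop) : onorm (ostar x * x) = onorm x ^+ 2.
Proof.
have := @cnorm_star R E (star (x : E)).
by rewrite starK cnorm_starE.
Qed.

HB.instance Definition _ := @isCstarAlgebra.Build R Eop ostar onorm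
  (@starK R E) (@starD R E) (@starZ R E) op_starM (@cnormD R E) (@cnormZ R E)
  (@cnorm0_eq0 R E) op_cnormM op_cnorm_star (@cnorm_complete R E).
End Opposite.

(* *-representations on a Hilbert space, not assumed to be unital. *)
Record starRep (R : realType) (E : cstarType R) (H : hilbertType R) := StarRep {
  rep :> E -> {linear H -> H};
  rep_bounded : forall a : E, continuous (rep a);
  rep_linear : forall (k : R[i]) (a b : E) (x : H),
    rep (k *: a + b) x = k *: rep a x + rep b x;
  repM : forall (a b : E) (x : H), rep (a * b) x = rep a (rep b x);
  rep_star : forall (a : E) (x y : H),
    inner (rep a x) y = inner x (rep (star a) y) }.

Definition linear_span (R : realType) (V : lmodType R[i]) (S : set V) : set V :=
  [set v | exists2 s : seq (R[i] * V), (forall p, p \in s -> S p.2) &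
                                       v = \sum_(p <- s) p.1 *: p.2].

Definition nondegenerate (R : realType) (E : cstarType R) (H : hilbertType R)
    (pi : starRep E H) : Prop :=
  dense (linear_span [set v : H | exists a x, v = pi a x]).

(* +oo when T is unbounded. *)
Definition opnorm (R : realType) (H : hilbertType R) (T : H -> H) : \bar R :=
  ereal_sup [set (complex.Re `|T x|)%:E | x in [set x : H | `|x| <= 1]].

(* An element of the algebraic tensor product of B and D is represented by a
   formal sum t of elementary tensors, t = \sum_(p <- t) p.1 (x) p.2. *)

(* Supremum over all pairs of commuting *-representations of B and D on one
   Hilbert space, i.e. over all *-representations of the algebraic tensor
   product. *)
Definition max_norm (R : realType) (B D : cstarType R) (t : seq (B * D)) :
    \bar R :=
  ereal_sup [set v | exists (H : hilbertType R) (pi : starRep B H)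
      (rho : starRep D H),
    (forall b d x, pi b (rho d x) = rho d (pi b x)) /\
    v = opnorm (fun x => \sum_(p <- t) pi p.1 (rho p.2 x))].

(* L, with tau x y the elementary tensor of x and y, is the Hilbert space
   tensor product of H and K. *)
Definition hilbert_tensor (R : realType) (H K L : hilbertType R)
    (tau : {bilinear H -> K -> L}) : Prop :=
  (forall x x' y y',
     inner (tau x y) (tau x' y') = inner x x' * inner y y') /\
  dense (linear_span [set v : L | exists x y, v = tau x y]).

(* The spatial norm: T is the operator (pi (x) rho)(t) on the Hilbert space
   tensor product L of H and K. *)
Definition min_norm (R : realType) (B D : cstarType R) (t : seq (B * D)) :
    \bar R :=
  ereal_sup [set v | exists (H K L : hilbertType R)
      (tau : {bilinear H -> K -> L}) (pi : starRep B H) (rho : starRep D K)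
      (T : {linear L -> L}),
    [/\ hilbert_tensor tau, continuous T,
        forall x y, T (tau x y) = \sum_(p <- t) tau (pi p.1 x) (rho p.2 y) &
        v = opnorm T]].

(* A, with b (x) d := iB b * iD d, is the completion of the algebraic tensor
   product of B and D for the C*-norm N. *)
Definition tensor_completion (R : realType) (B D A : cstarType R)
    (N : seq (B * D) -> \bar R)
    (iB : {lrmorphism B -> A}) (iD : {lrmorphism D -> A}) : Prop :=
  [/\ (forall b, iB (star b) = star (iB b)) /\
        (forall d, iD (star d) = star (iD d)),
      forall b d, iB b * iD d = iD d * iB b,
      forall t : seq (B * D),
        (cnorm (\sum_(p <- t) iB p.1 * iD p.2))%:E = N t &
      forall (a : A) (e : R), 0 < e -> exists t : seq (B * D),
        cnorm (a - \sum_(p <- t) iB p.1 * iD p.2) < e].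

Definition max_tensor (R : realType) (B D A : cstarType R) :=
  @tensor_completion R B D A (@max_norm R B D).

Definition min_tensor (R : realType) (B D A : cstarType R) :=
  @tensor_completion R B D A (@min_norm R B D).

(* Unital Hilbert bimodules over E. The left and right actions are
   *-representations of E and E^op, and the last field says that they come from
   a non-degenerate *-representation of the maximal tensor product of E and
   E^op; the latter being determined up to isomorphism, the condition is stated
   for every M that realizes it. *)
Record hilbertBimod (R : realType) (E : cstarType R) := HilbertBimod {
  bimod :> hilbertType R;
  lact : starRep E bimod;
  ract : starRep (E^c)%type bimod;
  lact1 : forall x, lact 1 x = x;
  ract1 : forall x, ract 1 x = x;
  lactrC : forall a b x, lact a (ract b x) = ract b (lact a x);
  lract_max : forall (M : cstarType R) (iL : {lrmorphism E -> M})
      (iR : {lrmorphism (E^c)%type -> M}), max_tensor iL iR ->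
    exists2 pi : starRep M bimod, nondegenerate pi &
      forall a b x, pi (iL a * iR b) x = ract b (lact a x) }.

Section PropertyT.
Variables (R : realType) (E : cstarType R).

Definition ad (H : hilbertBimod E) (a : E) (x : H) : H :=
  lact H a x - ract H a x.

Definition central (H : hilbertBimod E) : set H := [set x | forall a, ad a x = 0].
Arguments central H : clear implicits.

(* P^E_H x is the vector p of H^E such that x - p is orthogonal to H^E. *)
Definition central_proj (H : hilbertBimod E) (x : H) : H :=
  xget 0 [set p | central H p /\ forall y, central H y -> inner (x - p) y = 0].

Definition Vset (H : hilbertBimod E) (Q : set E) (beta : R) : set H :=
  [set x | `|x| = 1 /\ forall a, Q a -> `|ad a x| < beta%:C].
Arguments Vset H Q beta : clear implicits.

Definition propertyT : Prop :=
  exists (F : set E) (eps : R), [/\ finite_set F, F !=set0, 0 < eps &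
    forall H : hilbertBimod E,
      Vset H F eps !=set0 -> central H <> [set 0]].

Definition strong_propertyT : Prop :=
  forall alpha : R, 0 < alpha ->
  exists (Q : set E) (beta : R), [/\ finite_set Q, Q !=set0, 0 < beta &
    forall (H : hilbertBimod E) (x : H),
      Vset H Q beta x -> `|x - central_proj x| < alpha%:C].

Definition directed (I : Type) (le : I -> I -> Prop) : Prop :=
  [/\ inhabited I, forall i, le i i,
      forall i j k, le i j -> le j k -> le i k &
      forall i j, exists k, le i k /\ le j k].

Definition almost_central_unit_vector (H : hilbertBimod E) (I : Type)
    (le : I -> I -> Prop) (xi : I -> H) : Prop :=
  [/\ directed le, forall i, `|xi i| = 1 &
      forall (a : E) (e : R), 0 < e ->
        exists i0, forall i, le i0 i -> `|ad a (xi i)| < e%:C].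

Definition has_almost_central_unit_vector : Prop :=
  exists (K : hilbertBimod E) (J : Type) (le : J -> J -> Prop) (eta : J -> K),
    almost_central_unit_vector le eta.

End PropertyT.

(* Main.v *)
(* Writing 1 - a^*a = s^*s when |a| < 1 shows that *-representations are
   contractive, even on formal linear combinations of vectors; hence every pair
   of commuting unital actions of E and E^op gives a Hilbert bimodule, and all
   the Hilbert spaces needed come from positive definite kernels.
   (a) In an A-bimodule, an almost central unit vector for A is close to a
   B-central vector by strong property (T) of B, and the B-central vectors form
   a D-bimodule whose central vectors are A-central.
   (b) If the sets V_H(Q, beta) were never empty for all H at once, the direct
   sum of bimodules witnessing this would have an almost central unit vector.
   So V_H(Q, beta) is empty for all H and some (Q, beta), for D and then for A.
   (c) For a B-bimodule H, the tensor product of H and K is an A0-bimodule (the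
   right action is bounded by the minimal norm because it is a left action on
   the conjugate space). If x is almost B-central then x (x) eta_j is almost
   A0-central, and the slice map by eta_j sends a nearby central vector back to
   a B-central vector near x; slices also detect non-zero central vectors.
   (d) follows from (b) for D itself and (c). *)

From HB Require Import structures.
Require Import Defs.
From mathcomp Require Import all_boot all_order all_algebra.
From mathcomp Require Import complex lra ring.
From mathcomp Require Import all_classical all_reals all_analysis.

Set Implicit Arguments.
Unset Strict Implicit.
Unset Printing Implicit Defensive.

Import Order.TTheory GRing.Theory Num.Theory.
Import numFieldNormedType.Exports.

Local Open Scope classical_set_scope.
Local Open Scope complex_scope.
Local Open Scope ring_scope.

(** * Real-valued norms and sequences *)

(** The Hilbert spaces come from kernels, so only the inner products of a generating family are
    known, and an operator prescribed on that family could fail to be well defined. Contractivity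
    removes this obstacle: its proof uses only algebraic identities, which can be checked on
    generators, and it applies to formal combinations before any operator exists; a combination that
    represents 0 is then sent to one that represents 0. In this way [rep_on_family] produces the
    actions on tensor products, conjugate spaces, spaces of B-central vectors and direct sums alike.

    In (a) the hypotheses on B and D differ because the B-central vector must stay near the given
    unit vector in order to be still almost D-central; property (T) of B would only give some
    non-zero B-central vector. In (c) the strong case rests on a distance argument: a contraction
    that maps u to x and central vectors to central vectors does not increase the distance to the
    central vectors, and the projection realises that distance. *)

Definition nm (R : realType) (V : normedZmodType R[i]) (x : V) : R :=
  complex.Re `|x|.

Section RealNorm.
Variables (R : realType) (V : normedZmodType R[i]).
Implicit Types x y : V.

Lemma nmE x : `|x| = (nm x)%:C.
Proof. by rewrite /nm RRe_real// ger0_real. Qed.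

Lemma nm_ge0 x : 0 <= nm x.
Proof. by rewrite -ler0c -nmE normr_ge0. Qed.

Lemma nm0 : nm (0 : V) = 0.
Proof. by rewrite /nm normr0. Qed.

Lemma nm_eq0 x : nm x = 0 -> x = 0.
Proof. by move=> x0; apply/normr0_eq0; rewrite nmE x0. Qed.

Lemma nm_le0 x : nm x <= 0 -> x = 0.
Proof. by move=> x0; apply/nm_eq0/eqP; rewrite eq_le x0 nm_ge0. Qed.

Lemma nmN x : nm (- x) = nm x.
Proof. by rewrite /nm normrN. Qed.

Lemma nmBC x y : nm (x - y) = nm (y - x).
Proof. by rewrite /nm distrC. Qed.

Lemma nmD x y : nm (x + y) <= nm x + nm y.
Proof. by rewrite -lecR rmorphD/= -!nmE ler_normD. Qed.

Lemma nmB x y : nm (x - y) <= nm x + nm y.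
Proof. by rewrite -(nmN y) nmD. Qed.

Lemma nm_dist y x (t : V) : nm (x - t) <= nm (x - y) + nm (y - t).
Proof. by rewrite (le_trans _ (nmD _ _))// addrA subrK. Qed.

Lemma nm_lerB x y : nm x - nm y <= nm (x - y).
Proof. by rewrite lerBlDr (le_trans _ (nmD _ _))// subrK. Qed.

Lemma nm_sum I (s : seq I) (F : I -> V) :
  nm (\sum_(i <- s) F i) <= \sum_(i <- s) nm (F i).
Proof.
elim: s => [|i s IH]; first by rewrite !big_nil nm0.
by rewrite !big_cons (le_trans (nmD _ _))// lerD2l.
Qed.

Lemma ltr_normC x (e : R) : (`|x| < e%:C) = (nm x < e).
Proof. by rewrite nmE ltcR. Qed.

End RealNorm.

Section ComplexModulus.
Variable R : realType.
Implicit Types z w : R[i].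

Lemma nmM z w : nm (z * w) = nm z * nm w.
Proof. by apply/complexI; rewrite rmorphM/= -!nmE normrM. Qed.

Lemma nmV z : nm (z^-1) = (nm z)^-1.
Proof. by apply/complexI; rewrite fmorphV/= -!nmE normfV. Qed.

Lemma nm1 : nm (1 : R[i]) = 1.
Proof. by rewrite /nm normr1. Qed.

Lemma nm_conj z : nm (Num.conj z : R[i]) = nm z.
Proof. by rewrite /nm norm_conjC. Qed.

Lemma nm_real (r : R) : nm r%:C = `|r|.
Proof. by rewrite /nm normc_def/= expr0n addr0 sqrtr_sqr. Qed.

Lemma conjC_mul z : z * Num.conj z = (nm z ^+ 2)%:C.
Proof. by rewrite -normCK nmE rmorphXn. Qed.

Lemma ler_Re_nm z : `|complex.Re z| <= nm z.
Proof. by rewrite -lecR -nmE normc_ge_Re. Qed.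

Lemma Re_le_nm z : complex.Re z <= nm z.
Proof. exact: le_trans (ler_norm _) (ler_Re_nm z). Qed.

Lemma cRe_conj z : complex.Re (Num.conj z) = complex.Re z.
Proof. by case: z. Qed.

Lemma ReD z w : complex.Re (z + w) = complex.Re z + complex.Re w.
Proof. by case: z; case: w. Qed.

Lemma ReN z : complex.Re (- z) = - complex.Re z.
Proof. by case: z. Qed.

Lemma conj_real (r : R) : Num.conj (r%:C) = r%:C.
Proof. exact: conjc_real. Qed.

Lemma cconjM z w : Num.conj (z * w) = Num.conj z * Num.conj w.
Proof. exact: rmorphM. Qed.

Lemma cconjK z : Num.conj (Num.conj z) = z.
Proof. exact: conjCK. Qed.

Lemma cconj_sum I (s : seq I) (F : I -> R[i]) :
  Num.conj (\sum_(i <- s) F i) = \sum_(i <- s) Num.conj (F i).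
Proof. exact: rmorph_sum. Qed.

Lemma nm_le_Re_Im z : nm z <= `|complex.Re z| + `|complex.Im z|.
Proof.
rewrite [z in nm z]complexE (le_trans (nmD _ _))// nmM !nm_real.
have -> : nm ('i%C : R[i]) = 1.
  by rewrite /nm normc_def/= expr0n expr1n add0r sqrtr1.
by rewrite mul1r.
Qed.

Lemma ler_Im_nm z : `|complex.Im z| <= nm z.
Proof.
rewrite -normrN -ReiNIm (le_trans (ler_Re_nm _))// nmM.
by rewrite {2}/nm normc_def/= expr0n expr1n add0r sqrtr1 mulr1.
Qed.
End ComplexModulus.

Section Sequences.
Variables (R : realType) (V : zmodType) (p : V -> R).

(** The size function [p] is a parameter, so that the same notions serve normed modules through [nm]
    and the reals through the absolute value. *)
Definition converges (u : nat -> V) (l : V) := forall e : R, 0 < e ->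
  exists N : nat, forall n : nat, (N <= n)%N -> p (u n - l) < e.

Definition cauchy_seq (u : nat -> V) := forall e : R, 0 < e ->
  exists N : nat, forall m n : nat, (N <= m)%N -> (N <= n)%N -> p (u m - u n) < e.
End Sequences.

Lemma invS_lt (R : realType) (e : R) : 0 < e ->
  exists N : nat, forall n : nat, (N <= n)%N -> n.+1%:R^-1 < e.
Proof.
by move=> e0; have [N _ HN] := near_infty_natSinv_lt (PosNum e0); exists N.
Qed.

(** Sequences obtained by countable choice with error 1/(n+1) come in this form. *)
Lemma le_invS_cauchy (R : realType) (V : zmodType) (p : V -> R) (u : nat -> V) :
  (forall m n, p (u m - u n) <= m.+1%:R^-1 + n.+1%:R^-1) -> cauchy_seq p u.
Proof.
move=> H e e0; have [N HN] := invS_lt (e := e / 2) ltac:(lra).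
exists N => m n /HN mN /HN nN; rewrite (le_lt_trans (H _ _))//.
by rewrite [e]splitr ltrD.
Qed.

Lemma ler_eps (R : realType) (x y : R) : (forall e, 0 < e -> x <= y + e) -> x <= y.
Proof. by move=> H; apply/ler_addgt0Pr. Qed.

Section NormedModules.
Variables (R : realType) (V : normedModType R[i]).
Implicit Types x y : V.

Lemma nmZ (k : R[i]) x : nm (k *: x) = nm k * nm x.
Proof. by apply/complexI; rewrite rmorphM/= -!nmE normrZ. Qed.

Lemma ball_nm x y (e : R) : ball x e%:C y = (nm (x - y) < e) :> Prop.
Proof. by rewrite -ball_normE /ball_/= ltr_normC. Qed.

Lemma pos_complexE (e : R[i]) : 0 < e -> exists2 r : R, 0 < r & e = r%:C.
Proof.
move=> e0; exists (complex.Re e); last by rewrite RRe_real// gtr0_real.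
by rewrite -ltcR RRe_real// gtr0_real.
Qed.

Lemma denseP (S : set V) : dense S <->
  forall x (e : R), 0 < e -> exists2 y, S y & nm (x - y) < e.
Proof.
split=> [dS x e e0|dS O [x Ox] oO].
  have [] := dS (ball x e%:C); [|exact: ball_open|].
    by exists x; apply: ballxx; rewrite ltcR.
  by move=> y [xy Sy]; exists y => //; rewrite -ball_nm.
have /nbhs_ballP[_ /pos_complexE[r r0 ->] rO] : nbhs x O by exact: open_nbhs_nbhs.
by have [y Sy xy] := dS x r r0; exists y; split=> //; apply: rO; rewrite ball_nm.
Qed.

Lemma bounded_continuous (W : normedModType R[i]) (f : {linear V -> W}) (M : R) :
  (forall x, nm (f x) <= M * nm x) -> continuous f.
Proof.
move=> fM x; apply/cvgrPdist_lt => _ /pos_complexE[e e0 ->].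
have M1 : 0 < `|M| + 1 by rewrite ltr_wpDl.
apply/nbhs_ballP; exists (e / (`|M| + 1))%:C.
  by rewrite /= ltcR divr_gt0.
move=> y; rewrite ball_nm => xy; rewrite ltr_normC -linearB.
rewrite (le_lt_trans (fM _))//.
rewrite ltr_pdivlMr// in xy; rewrite (le_lt_trans _ xy)// mulrC ler_wpM2l ?nm_ge0//.
by rewrite (le_trans (ler_norm _))// lerDl.
Qed.

(** Completeness for filters is reduced to sequences: balls of radius 1/(n+1) belonging to the
    filter meet pairwise, so their centres form a Cauchy sequence, and its limit is the limit of the
    filter. *)
Lemma filter_cauchy_cvg :
  (forall u, cauchy_seq (@nm R V) u -> exists l, converges (@nm R V) u l) ->
  forall F : set_system V, ProperFilter F -> cauchy F -> cvg F.
Proof.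
move=> complV F FF /cauchyP Fc.
have /choice[u uP] (n : nat) : exists x, F (ball x n.+1%:R^-1%:C).
  by apply: Fc; rewrite ltcR invr_gt0.
have [l lP] : exists l, converges (@nm R V) u l.
  apply/complV/le_invS_cauchy => m n.
  have [y [/=]] := filter_ex (filterI (uP m) (uP n)).
  rewrite !ball_nm => ym yn; rewrite (le_trans (nm_dist y _ _))//.
  by rewrite lerD// ltW// nmBC.
apply/cvg_ex; exists l; apply/fcvg_ballP => _ /pos_complexE[e e0 ->].
have [N1 H1] := lP (e / 2) ltac:(lra).
have [N2 H2] := invS_lt (e := e / 2) ltac:(lra).
have /H1 a1 := leq_maxl N1 N2; have /H2 a2 := leq_maxr N1 N2.
apply: filterS (uP (maxn N1 N2)) => y; rewrite !ball_nm => uy.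
rewrite (le_lt_trans (nm_dist (u (maxn N1 N2)) _ _))// (nmBC l).
by rewrite [e]splitr ltrD// (lt_trans uy).
Qed.
End NormedModules.

Lemma complete_seq (R : realType) (V : completeNormedModType R[i]) (u : nat -> V) :
  cauchy_seq (@nm R V) u -> exists l, converges (@nm R V) u l.
Proof.
move=> uc; have : cvg (u @ \oo).
  apply: cauchy_cvg; apply: cauchy_exP => _ /pos_complexE[e e0 ->].
  have [N HN] := uc e e0; exists (u N); exists N => // n /= Nn.
  by rewrite ball_nm; apply: HN.
move=> /cvg_ex[l ul]; exists l => e e0.
have /cvgrPdist_lt/(_ e%:C) := ul; rewrite ltcR => /(_ e0)[N _ HN].
by exists N => n /HN/=; rewrite ltr_normC nmBC.
Qed.

Lemma complete_seq_real (R : realType) (u : nat -> R) :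
  cauchy_seq (fun x : R => `|x|) u -> exists l, converges (fun x : R => `|x|) u l.
Proof.
move=> uc; have : cvg (u @ \oo).
  apply: cauchy_cvg; apply: cauchy_exP => e e0.
  have [N HN] := uc e e0; exists (u N); exists N => // n /= Nn.
  by apply: HN.
move=> /cvg_ex[l ul]; exists l => e e0.
have /cvgrPdist_lt/(_ e e0)[N _ HN] := ul.
by exists N => n /HN/=; rewrite distrC.
Qed.

Lemma complete_seq_complex (R : realType) (u : nat -> R[i]) :
  cauchy_seq (@nm R R[i]) u -> exists l, converges (@nm R R[i]) u l.
Proof.
move=> uc.
have [a Ha] : exists a, converges (fun x : R => `|x|) (fun n => complex.Re (u n)) a.
  apply: complete_seq_real => e e0; have [N HN] := uc e e0; exists N => m n Nm Nn.
  by rewrite -raddfB (le_lt_trans (ler_Re_nm _))// HN.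
have [b Hb] : exists b, converges (fun x : R => `|x|) (fun n => complex.Im (u n)) b.
  apply: complete_seq_real => e e0; have [N HN] := uc e e0; exists N => m n Nm Nn.
  by rewrite -raddfB (le_lt_trans (ler_Im_nm _))// HN.
exists (a +i* b) => e e0.
have [N1 H1] := Ha (e / 2) ltac:(lra); have [N2 H2] := Hb (e / 2) ltac:(lra).
exists (maxn N1 N2) => n; rewrite geq_max => /andP[/H1 h1 /H2 h2].
rewrite (le_lt_trans (nm_le_Re_Im _))//.
by rewrite !raddfB/=; lra.
Qed.

(** * Hilbert spaces *)

(* Take l = - conj z / b, or a large multiple of - conj z when b = 0. *)
Lemma quadratic_discr (R : realType) (a b : R) (z : R[i]) : 0 <= b ->
  (forall l : R[i], 0 <= a + 2 * complex.Re (l * z) + nm l ^+ 2 * b) ->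
  nm z ^+ 2 <= a * b.
Proof.
move=> b0 H.
have key (t : R) : 0 <= a - 2 * t * nm z ^+ 2 + t ^+ 2 * nm z ^+ 2 * b.
  have := H (- (t%:C * Num.conj z)).
  rewrite nmN nmM nm_real nm_conj exprMn real_normK ?num_real//.
  have -> : - (t%:C * Num.conj z) * z = - (t * nm z ^+ 2)%:C.
    by rewrite mulNr -mulrA (mulrC _ z) conjC_mul -rmorphM.
  by rewrite ReN mulrN mulrA.
move: b0; rewrite le_eqVlt => /predU1P[b0|b0]; last first.
  have := key b^-1.
  have -> : a - 2 * b^-1 * nm z ^+ 2 + b^-1 ^+ 2 * nm z ^+ 2 * b =
     (a * b - nm z ^+ 2) / b by field; rewrite gt_eqF.
  by rewrite pmulr_lge0 ?invr_gt0// subr_ge0.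
rewrite -b0 mulr0; case: (ltrP 0 (nm z ^+ 2)) => // z0.
have := key ((a + 1) / (2 * nm z ^+ 2)); rewrite -b0 mulr0 addr0.
have -> : 2 * ((a + 1) / (2 * nm z ^+ 2)) * nm z ^+ 2 = a + 1.
  by field; rewrite -sqrf_eq0 gt_eqF.
lra.
Qed.

Definition ip (R : realType) (H : hilbertType R) (x y : H) : R[i] := inner x y.

Section HilbertSpace.
Variables (R : realType) (H : hilbertType R).
Implicit Types (x y z : H) (k : R[i]).

Lemma ipC x y : ip x y = Num.conj (ip y x).
Proof. by rewrite [LHS](hermC inner) expr0 mul1r. Qed.

Lemma ipDl x y z : ip (x + y) z = ip x z + ip y z.
Proof. exact: linearDl. Qed.
Lemma ipBl x y z : ip (x - y) z = ip x z - ip y z.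
Proof. exact: linearBl. Qed.
Lemma ipZl k x y : ip (k *: x) y = k * ip x y.
Proof. exact: linearZl_LR. Qed.
Lemma ip0l y : ip 0 y = 0.
Proof. exact: linear0l. Qed.
Lemma ipDr x y z : ip x (y + z) = ip x y + ip x z.
Proof. exact: linearDr. Qed.
Lemma ipBr x y z : ip x (y - z) = ip x y - ip x z.
Proof. exact: linearBr. Qed.
Lemma ipZr k x y : ip x (k *: y) = Num.conj k * ip x y.
Proof. exact: linearZr_LR. Qed.
Lemma ip0r x : ip x 0 = 0.
Proof. exact: linear0r. Qed.

Lemma ip_suml I (s : seq I) (F : I -> H) y :
  ip (\sum_(i <- s) F i) y = \sum_(i <- s) ip (F i) y.
Proof.
by elim: s => [|i s IH]; rewrite ?big_nil ?ip0l// !big_cons ipDl IH.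
Qed.

Lemma ip_sumr I (s : seq I) (F : I -> H) x :
  ip x (\sum_(i <- s) F i) = \sum_(i <- s) ip x (F i).
Proof.
by elim: s => [|i s IH]; rewrite ?big_nil ?ip0r// !big_cons ipDr IH.
Qed.

Lemma ipxx x : ip x x = (nm x ^+ 2)%:C.
Proof. by rewrite [LHS]inner_norm nmE rmorphXn. Qed.

Lemma Re_ipxx x : complex.Re (ip x x) = nm x ^+ 2.
Proof. by rewrite ipxx. Qed.

Lemma sqr_nmD x y :
  nm (x + y) ^+ 2 = nm x ^+ 2 + 2 * complex.Re (ip x y) + nm y ^+ 2.
Proof.
rewrite -!Re_ipxx !(ipDl, ipDr) !ReD (ipC y x) cRe_conj; ring.
Qed.

Lemma sqr_nmB x y :
  nm (x - y) ^+ 2 = nm x ^+ 2 - 2 * complex.Re (ip x y) + nm y ^+ 2.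
Proof. by rewrite sqr_nmD -scaleN1r ipZr nmZ nmN nm1 mul1r rmorphN1 mulN1r ReN mulrN. Qed.

Lemma cauchy_schwarz x y : nm (ip x y) <= nm x * nm y.
Proof.
rewrite -(@ler_pXn2r _ 2)// ?nnegrE ?mulr_ge0 ?nm_ge0// exprMn.
rewrite mulrC [leRHS]mulrC; apply: quadratic_discr; first exact: sqr_ge0.
move=> l; have := sqr_ge0 (nm (x + Num.conj l *: y)).
by rewrite sqr_nmD ipZr conjCK nmZ nm_conj exprMn.
Qed.

(** Used to bound a vector by pairing it with itself and moving an operator to the other side. *)
Lemma ip_nm_le x (M : R) : 0 <= M ->
  nm (ip x x) <= M * nm x -> nm x <= M.
Proof.
move=> M0; rewrite ipxx nm_real ger0_norm ?sqr_ge0// => h.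
have [->|x0] := eqVneq (nm x) 0; first by [].
have xp : 0 < nm x by rewrite lt_def x0 nm_ge0.
by rewrite -(ler_pM2r xp) -expr2.
Qed.

(* The parallelogram law turns a minimising sequence into a Cauchy sequence. *)
Lemma projection_theorem (S : set H) x :
  S 0 -> (forall k y z, S y -> S z -> S (k *: y + z)) ->
  (forall u y, (forall n, S (u n)) -> converges (@nm R H) u y -> S y) ->
  exists2 y, S y & forall z, S z -> ip (x - y) z = 0.
Proof.
move=> S0 Slin Scl.
pose D := [set r | exists2 y, S y & r = nm (x - y) ^+ 2].
have D0 : D !=set0 by exists (nm (x - 0) ^+ 2), 0.
have Dlb : has_lbound D by exists 0 => _ [y _ ->]; exact: sqr_ge0.
have Dinf : has_inf D by [].
pose d := inf D.
have dle y : S y -> d <= nm (x - y) ^+ 2.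
  by move=> Sy; apply: ge_inf => //; exists y.
have /choice[u uP] (n : nat) :
    exists y, S y /\ nm (x - y) ^+ 2 < d + (n.+1%:R^-1) ^+ 2.
  have [|_ [y Sy ->] h] := @inf_adherent _ D (n.+1%:R^-1 ^+ 2) _ Dinf.
    by rewrite exprn_gt0 ?invr_gt0.
  by exists y.
(* The midpoint of [y] and [z] lies in [S], hence at squared distance at least [d] from [x]; this
   leaves at most 2(e^2 + f^2) for |y - z|^2. *)
have half y z (e f : R) : S y -> S z -> 0 <= e -> 0 <= f ->
    nm (x - y) ^+ 2 < d + e ^+ 2 -> nm (x - z) ^+ 2 < d + f ^+ 2 ->
    nm (y - z) <= 2 * (e + f).
  move=> Sy Sz e0 f0 hy hz.
  have Sm : S (2^-1 *: y + 2^-1 *: z).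
    by apply: (Slin) => //; rewrite -[_ *: z]addr0; exact: Slin.
  have hm := dle _ Sm.
  have h2 : (2 : R[i]) != 0 by rewrite pnatr_eq0.
  have e1 : (x - z) + (x - y) = 2 *: (x - (2^-1 *: y + 2^-1 *: z)).
    rewrite scalerBr scalerDr !scalerA !divff// !scale1r scaler_nat mulr2n.
    by rewrite opprD addrACA (addrC (- z)).
  have e2 : (x - z) - (x - y) = y - z.
    by rewrite opprB addrC addrA subrK.
  have h3 := sqr_nmD (x - z) (x - y); have h4 := sqr_nmB (x - z) (x - y).
  rewrite e1 nmZ in h3; rewrite e2 in h4.
  have nm2 : nm (2 : R[i]) = 2.
    by have := @nm_real R 2; rewrite ger0_norm// => <-; rewrite rmorph_nat.
  rewrite nm2 exprMn in h3.
  rewrite -(@ler_pXn2r _ 2)// ?nnegrE ?mulr_ge0 ?addr_ge0 ?nm_ge0//.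
  have : 0 <= e * f by rewrite mulr_ge0.
  by nra.
have uc : cauchy_seq (@nm R H) u.
  move=> e e0; have [N HN] := invS_lt (e := e / 4) ltac:(lra).
  exists N => m n /HN mN /HN nN.
  have [Sm hm] := uP m; have [Sn hn] := uP n.
  rewrite (le_lt_trans (half _ _ _ _ Sm Sn _ _ hm hn)) ?invr_ge0//.
  have -> : e = 2 * (e / 4 + e / 4) by field.
  by rewrite ltr_pM2l// ltrD.
have [y uy] := complete_seq uc.
have Sy : S y by apply: Scl uy => n; case: (uP n).
have ydist : nm (x - y) ^+ 2 <= d.
  apply: ler_eps => e e0.
  (* Once |u_n - y| and 1/(n+1) are below [e' / 2] and [e' <= 1], the square |x - y|^2 exceeds [d]
     by at most e'(|x - y| + 1). *)
  have e'0 : 0 < Num.min 1 (e / (2 * (nm (x - y) + 1))).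
    by rewrite lt_min ltr01 divr_gt0 ?mulr_gt0// ltr_wpDl ?nm_ge0.
  set e' := Num.min _ _ in e'0.
  have [N1 H1] := uy (e' / 2) ltac:(lra).
  have [N2 H2] := invS_lt (e := e' / 2) ltac:(lra).
  have /H1 a1 := leq_maxl N1 N2; have /H2 a2 := leq_maxr N1 N2.
  set n := maxn N1 N2 in a1 a2; have [_ a3] := uP n.
  have a4 : nm (x - y) <= nm (x - u n) + nm (u n - y) by exact: nm_dist.
  have a5 : nm (x - u n) <= nm (x - y) + nm (u n - y) by rewrite (nmBC (u n)) nm_dist.
  have e1 : e' <= 1 by rewrite /e' ge_min lexx.
  have e2 : e' * (2 * (nm (x - y) + 1)) <= e.
    rewrite -ler_pdivlMr ?mulr_gt0 ?ltr_wpDl ?nm_ge0//.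
    by rewrite /e' ge_min lexx orbT.
  have b0 : 0 < n.+1%:R^-1 :> R by rewrite invr_gt0.
  move: (nm_ge0 (x - y)) (nm_ge0 (x - u n)) (nm_ge0 (u n - y)).
  clear H1 H2; move: b0 a1 a2 a3 a4 a5 e1 e2 e'0.
  move: (nm (x - y)) (nm (x - u n)) (nm (u n - y)) (n.+1%:R^-1) e'.
  move=> X U W b e' b0 We be a3 XUW UXW e1 e2 e'0 X0 U0 W0.
  have h1 : X ^+ 2 <= (U + W) ^+ 2 by rewrite ler_pXn2r ?nnegrE//; lra.
  have h2 : W * U <= W * (X + W) by rewrite ler_wpM2l.
  have h3 : W * W <= W * (e' / 2) by rewrite ler_wpM2l// ltW.
  have h4 : b * b <= (e' / 2) * (1 / 2) by rewrite ler_pM//; lra.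
  have h5 : W * (2 * X + 3 / 2) <= e' / 2 * (2 * X + 3 / 2).
    by rewrite ler_wpM2r//; lra.
  have h6 : W * e' <= W * 1 by rewrite ler_wpM2l.
  rewrite !expr2 in h1 a3 *; lra.
exists y => // z Sz.
apply: nm_eq0; apply/eqP; rewrite -sqrf_eq0 eq_le sqr_ge0 andbT.
(* Minimality of [y] against y - conj(l) z is the discriminant criterion with constant term 0, which
   forces the inner product to vanish. *)
have := @quadratic_discr R 0 (nm z ^+ 2) (ip (x - y) z).
rewrite mul0r; apply; first exact: sqr_ge0.
move=> l; rewrite add0r.
pose m : R[i] := - Num.conj l.
have ml : Num.conj m = - l by rewrite /m rmorphN; congr (- _); exact: cconjK.
have nml : nm m = nm l by rewrite /m nmN nm_conj.
have h := dle _ (Slin m _ _ Sz Sy).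
have := sqr_nmB (x - y) (m *: z).
rewrite -addrA -opprD [y + _]addrC ipZr nmZ nml ml exprMn mulNr ReN; lra.
Qed.
End HilbertSpace.

(** * Contractivity of *-representations *)

Section CstarFacts.
Variables (R : realType) (E : cstarType R).
Implicit Types a b : E.

Lemma cn0 : cnorm (0 : E) = 0.
Proof.
have := @cnormZ R E 0 0; rewrite scaler0 normr0 mul0r.
by move=> /(congr1 (@complex.Re R)).
Qed.

Lemma cnZ (k : R[i]) a : cnorm (k *: a) = nm k * cnorm a.
Proof. by apply/complexI; rewrite cnormZ nmE rmorphM. Qed.

Lemma cnN a : cnorm (- a) = cnorm a.
Proof. by rewrite -scaleN1r cnZ nmN nm1 mul1r. Qed.

Lemma cnC a b : cnorm (a - b) = cnorm (b - a).
Proof. by rewrite -cnN opprB. Qed.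

Lemma cn_dist b a c : cnorm (a - c) <= cnorm (a - b) + cnorm (b - c).
Proof. by rewrite (le_trans _ (cnormD _ _))// addrA subrK. Qed.

Lemma cn_small a : (forall e : R, 0 < e -> cnorm a <= e) -> a = 0.
Proof.
move=> H; apply: cnorm0_eq0; apply/eqP; rewrite eq_le cnorm_ge0 andbT.
by apply: ler_eps => e /H; rewrite add0r.
Qed.

Lemma starN a : star (- a) = - star a.
Proof. by rewrite -scaleN1r starZ rmorphN1 scaleN1r. Qed.

Lemma starB a b : star (a - b) = star a - star b.
Proof. by rewrite starD starN. Qed.

Lemma star1 : star (1 : E) = 1.
Proof. by rewrite -[LHS]mulr1 -{2}[1]starK -starM mulr1 starK. Qed.

Lemma star0 : star (0 : E) = 0.
Proof. by rewrite -[in LHS](scale0r 0) starZ rmorph0 scale0r. Qed.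
End CstarFacts.

Lemma expr_small (R : realType) (r e : R) : 0 <= r < 1 -> 0 < e ->
  exists N : nat, forall n : nat, (N <= n)%N -> r ^+ n < e.
Proof.
move=> /andP[r0 r1] e0.
have /cvgrPdist_lt/(_ e e0)[N _ HN] : (GRing.exp r : nat -> R) @ \oo --> (0 : R).
  by apply: cvg_expr; rewrite ger0_norm.
exists N => n /HN/=; rewrite sub0r normrN ger0_norm//; exact: exprn_ge0.
Qed.

(* 1 - y is a square root of 1 - h when y is a fixed point of the contraction
   y |-> (h + y^2)/2 of the ball of radius cnorm h. *)
Lemma cstar_sqrt (R : realType) (E : cstarType R) (a : E) : cnorm a < 1 ->
  exists s : E, star s * s = 1 - star a * a.
Proof.
move=> a1; pose h := star a * a; pose r := cnorm h.
have r01 : 0 <= r < 1.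
  rewrite cnorm_ge0 /r/= cnorm_star expr_lt1//; exact: cnorm_ge0.
have [r0 r1] : 0 <= r /\ r < 1 by apply/andP.
have hh : star h = h by rewrite /h starM starK.
pose f (y : E) : E := 2^-1 *: (h + y * y).
have nm2V : nm (2^-1 : R[i]) = 2^-1.
  have -> : (2^-1 : R[i]) = (2^-1 : R)%:C by rewrite fmorphV rmorph_nat.
  by rewrite nm_real ger0_norm.
pose y n : E := iter n f 0.
have yS n : y n.+1 = f (y n) by [].
have yr n : cnorm (y n) <= r.
  elim: n => [|n IH]; first by rewrite cn0.
  rewrite yS cnZ nm2V; have := cnormD h (y n * y n); have := cnormM (y n) (y n).
  have : cnorm (y n) * cnorm (y n) <= r * r by rewrite ler_pM ?cnorm_ge0.
  have : r * r <= r * 1 by rewrite ler_wpM2l// ltW.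
  rewrite -/r; lra.
(* The difference of squares is u(u - v) + (u - v)v, without commutativity; the two terms use up the
   factor 1/2 in [f]. *)
have fcontr u v M : cnorm u <= M -> cnorm v <= M ->
    cnorm (f u - f v) <= M * cnorm (u - v).
  move=> uM vM; rewrite -scalerBr cnZ nm2V.
  have -> : h + u * u - (h + v * v) = u * (u - v) + (u - v) * v.
    by rewrite mulrBr mulrBl opprD addrACA subrr add0r addrA subrK.
  have h1 := cnormD (u * (u - v)) ((u - v) * v).
  have h2 := cnormM u (u - v); have h3 := cnormM (u - v) v.
  have h4 : cnorm u * cnorm (u - v) <= M * cnorm (u - v).
    by rewrite ler_wpM2r ?cnorm_ge0.
  have h5 : cnorm (u - v) * cnorm v <= M * cnorm (u - v).
    by rewrite mulrC ler_wpM2r ?cnorm_ge0.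
  lra.
have ygeo n k : cnorm (y (n + k)%N - y n) <= r ^+ n.
  elim: n => [|n IH]; first by rewrite subr0 expr0 (le_trans (yr _))// ltW.
  rewrite addSn !yS exprS (le_trans (fcontr _ _ r _ _))// ler_wpM2l//.
have [z zP] : exists z, forall e : R, 0 < e ->
    exists N : nat, forall n : nat, (N <= n)%N -> cnorm (y n - z) < e.
  apply: cnorm_complete => e e0; have [N HN] := expr_small r01 e0.
  exists N => m n Nm Nn; wlog mn : m n Nm Nn / (m <= n)%N.
    move=> W; have [/W|/ltnW/W] := leqP m n; first exact.
    by rewrite cnC; exact.
  by rewrite cnC -(subnKC mn) (le_lt_trans (ygeo _ _))// HN.
have starz : star z = z.
  apply/eqP; rewrite -subr_eq0; apply/eqP; apply: cn_small => e e0.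
  have [N /(_ N (leqnn N)) HN] := zP (e / 2) ltac:(lra).
  have stary : star (y N) = y N.
    elim: (N) => [|n IH]; first exact: star0.
    rewrite yS /f starZ (starD h) hh starM IH; congr (_ *: _).
    by rewrite fmorphV; congr (_^-1); exact: rmorph_nat.
  have := cn_dist (y N) (star z) z.
  rewrite -{1}stary -starB cnorm_starE (cnC z); lra.
have fz : f z = z.
  apply/eqP; rewrite -subr_eq0; apply/eqP; apply: cn_small => e e0.
  (* The radius has to cover [z] as well as the iterates, since the norm of the limit has not been
     compared with [r]. *)
  pose M := r + cnorm z.
  have M0 : 0 <= M by rewrite addr_ge0 ?cnorm_ge0.
  have [N HN] := zP (e / (M + 1)) ltac:(by rewrite divr_gt0// ltr_wpDl).
  have h1 := HN N (leqnn N); have h2 := HN N.+1 (leqnSn N).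
  have h3 := fcontr z (y N) M.
  have {}h3 : cnorm (f z - f (y N)) <= M * cnorm (z - y N).
    apply: h3; rewrite /M; first by rewrite lerDr.
    by rewrite (le_trans (yr _))// lerDl cnorm_ge0.
  rewrite (le_trans (cn_dist (f (y N)) _ _))//.
  rewrite yS in h2; rewrite (cnC z) in h3.
  have h4 : M * cnorm (y N - z) <= M * (e / (M + 1)) by rewrite ler_wpM2l// ltW.
  have h5 : (M + 1) * (e / (M + 1)) = e by field; rewrite gt_eqF// ltr_wpDl.
  lra.
exists (1 - z); rewrite starB star1 starz mulrBl !mulrBr !mul1r mulr1 -/h.
have : h = z + z - z * z.
  have -> : z + z = 2 *: z by rewrite scaler_nat mulr2n.
  by rewrite -[in 2 *: z]fz /f scalerA divff ?pnatr_eq0// scale1r addrK.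
by move=> ->; rewrite !opprB opprD !addrA (addrAC 1 (- z)).
Qed.

(* If cnorm a < 1 and 1 - a^*a = s^*s, then |v|^2 - |a v|^2 = |s v|^2. The map
   ev allows the action to be defined only on formal expressions for vectors. *)
Lemma star_action_contractive (R : realType) (E : cstarType R)
    (H : hilbertType R) (V : Type) (ev : V -> H) (act : E -> V -> V) :
  (forall a v w, ip (ev (act a v)) (ev w) = ip (ev v) (ev (act (star a) w))) ->
  (forall (k : R[i]) a b v,
     ev (act (k *: a + b) v) = k *: ev (act a v) + ev (act b v)) ->
  (forall a b v, ev (act (a * b) v) = ev (act a (act b v))) ->
  forall a v, nm (ev (act a v)) <= cnorm a * nm (ev v).
Proof.
move=> actS actL actM.
(* [act 1] need not be the identity; it behaves as a self-adjoint idempotent and is therefore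
   contractive. *)
have act1 v : nm (ev (act 1 v)) <= nm (ev v).
  apply: ip_nm_le; first exact: nm_ge0.
  rewrite actS star1 -actM mulr1 (le_trans (cauchy_schwarz _ _))//.
have lt1 a v : cnorm a < 1 -> nm (ev (act a v)) <= nm (ev v).
  move=> /cstar_sqrt[s sP].
  have e1 : star a * a = (-1) *: (star s * s) + 1 by rewrite scaleN1r sP opprB subrK.
  have : nm (ev (act a v)) ^+ 2 =
     - nm (ev (act s v)) ^+ 2 + complex.Re (ip (ev v) (ev (act 1 v))).
    rewrite -!Re_ipxx !actS -!actM e1 actL -ReN -ReD; congr complex.Re.
    by rewrite ipDr ipZr rmorphN1 mulN1r.
  have := le_trans (Re_le_nm _) (cauchy_schwarz (ev v) (ev (act 1 v))).
  have := sqr_ge0 (nm (ev (act s v))).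
  have := ler_wpM2l (nm_ge0 (ev v)) (act1 v).
  rewrite -[nm (ev (act a v)) <= _](@ler_pXn2r _ 2)// ?nnegrE ?nm_ge0// !expr2; lra.
move=> a v; apply: ler_eps => e e0.
have M1 : 0 < nm (ev v) + 1 by rewrite ltr_wpDl ?nm_ge0.
(* [c] exceeds the norm of [a] by so little that the excess times |v| is at most [e]; dividing [a]
   by [c] brings it into the open unit ball. *)
pose c : R := cnorm a + e / (nm (ev v) + 1).
have d0 : 0 < e / (nm (ev v) + 1) by rewrite divr_gt0.
have c0 : 0 < c by rewrite ltr_wpDl ?cnorm_ge0.
have := lt1 ((c^-1)%:C *: a) v.
rewrite cnZ nm_real ger0_norm ?invr_ge0 ?(ltW c0)// mulrC ltr_pdivrMr// mul1r ltrDl.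
have := actL (c^-1)%:C a 0 v; rewrite addr0 => ->.
(* This removes the term [act 0 v]: linearity with coefficient -1 writes it as -w + w. *)
have := actL (-1) 0 0 v; rewrite addr0 scaler0 scaleN1r => ->.
rewrite addNr addr0 nmZ nm_real ger0_norm ?invr_ge0 ?(ltW c0)// => /(_ d0).
rewrite mulrC ler_pdivrMr// => h; rewrite (le_trans h)// mulrC /c mulrDl lerD2l.
have h2 : e / (nm (ev v) + 1) * nm (ev v) <= e / (nm (ev v) + 1) * (nm (ev v) + 1).
  by rewrite ler_wpM2l ?(ltW d0)// lerDl.
by rewrite (le_trans h2)// divfK// gt_eqF.
Qed.

Section Reps.
Variables (R : realType) (E : cstarType R) (H : hilbertType R) (pi : starRep E H).

Lemma rep_contractive a x : nm (pi a x) <= cnorm a * nm x.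
Proof.
apply: (@star_action_contractive R E H H id (fun a x => pi a x)).
- exact: rep_star.
- exact: rep_linear.
- exact: repM.
Qed.

Lemma rep_ip a x y : ip (pi a x) y = ip x (pi (star a) y).
Proof. exact: rep_star. Qed.

Lemma repD a b x : pi (a + b) x = pi a x + pi b x.
Proof. by have := rep_linear pi 1 a b x; rewrite !scale1r. Qed.

Lemma rep0 x : pi 0 x = 0.
Proof. by apply: (addrI (pi 0 x)); rewrite -repD !addr0. Qed.

Lemma repZ k a x : pi (k *: a) x = k *: pi a x.
Proof. by have := rep_linear pi k a 0 x; rewrite !addr0 rep0 addr0. Qed.

End Reps.

(** * Extension by density *)

Definition mkLinear (K : nzRingType) (U V : lmodType K) (f : U -> V)
  (fl : linear f) : {linear U -> V} := HB.pack f (GRing.isLinear.Build K U V *:%R f fl).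

(* A list of pairs (coefficient, point) stands for a formal linear combination
   of points of X. *)
Definition ev (K : nzRingType) (V : lmodType K) (X : Type) (phi : X -> V)
  (t : seq (K * X)) : V := \sum_(p <- t) p.1 *: phi p.2.

Definition fscale (K : nzRingType) (X : Type) (k : K) (t : seq (K * X)) :=
  [seq (k * p.1, p.2) | p <- t].

Definition fmap (K : nzRingType) (X Y : Type) (f : X -> Y) (t : seq (K * X)) :=
  [seq (p.1, f p.2) | p <- t].

Section FormalSums.
Variables (K : nzRingType) (V : lmodType K) (X : Type) (phi : X -> V).
Implicit Types s t : seq (K * X).

Lemma ev_nil : ev phi [::] = 0. Proof. exact: big_nil. Qed.

Lemma ev_cons p t : ev phi (p :: t) = p.1 *: phi p.2 + ev phi t.
Proof. exact: big_cons. Qed.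

Lemma ev1 x : ev phi [:: (1, x)] = phi x.
Proof. by rewrite /ev big_seq1 scale1r. Qed.

Lemma ev_cat s t : ev phi (s ++ t) = ev phi s + ev phi t.
Proof. exact: big_cat. Qed.

Lemma ev_scale k t : ev phi (fscale k t) = k *: ev phi t.
Proof. by rewrite /ev big_map scaler_sumr; apply: eq_bigr => p _; rewrite scalerA. Qed.

Lemma ev_sub s t : ev phi (s ++ fscale (-1) t) = ev phi s - ev phi t.
Proof. by rewrite ev_cat ev_scale scaleN1r. Qed.

Lemma ev_fmap (Y : Type) (f : Y -> X) (t : seq (K * Y)) :
  ev phi (fmap f t) = ev (phi \o f) t.
Proof. by rewrite /ev big_map. Qed.

Lemma ev_linear (W : lmodType K) (F : V -> W) t :
  linear F -> F (ev phi t) = ev (F \o phi) t.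
Proof.
move=> Fl; pose G := mkLinear Fl; rewrite -[F]/(G : V -> W) /ev linear_sum.
by apply: eq_bigr => p _; rewrite linearZ.
Qed.

Lemma eq_ev (psi : X -> V) t : (forall x, phi x = psi x) -> ev phi t = ev psi t.
Proof. by move=> e; apply: eq_bigr => p _; rewrite e. Qed.

End FormalSums.

(** Passage from spans of sets of vectors to formal combinations of indexed points. *)
Lemma linear_spanP (R : realType) (V : lmodType R[i]) (X : Type) (phi : X -> V)
  (S : set V) v : (forall v, S v <-> exists x, v = phi x) ->
  linear_span S v <-> exists t, v = ev phi t.
Proof.
move=> SP; split=> [[s]|[t ->]]; last first.
  exists [seq (p.1, phi p.2) | p <- t]; last by rewrite big_map.
  elim: t => [|p t IH] q //; rewrite inE => /orP[/eqP->|/IH//].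
  by apply/SP; exists p.2.
elim: s v => [|p s IH] v Ss ->; first by exists [::]; rewrite big_nil ev_nil.
have [|t et] := IH _ _ erefl; first by move=> q qs; apply: Ss; rewrite inE qs orbT.
have /SP[x px] : S p.2 by apply: Ss; rewrite inE eqxx.
by exists ((p.1, x) :: t); rewrite ev_cons big_cons -et px.
Qed.

Section Extension.
Variables (R : realType) (L : lmodType R[i]) (p : L -> R).
Hypothesis pD : forall u v, p (u + v) <= p u + p v.
Hypothesis pZ : forall (k : R[i]) v, p (k *: v) = nm k * p v.
Variables (X : Type) (phi : X -> L).
Hypothesis phi_dense : forall v (e : R), 0 < e -> exists t, p (v - ev phi t) < e.

Let pC u v : p (u - v) = p (v - u).
Proof. by rewrite -opprB -[- (v - u)]scaleN1r pZ nmN nm1 mul1r. Qed.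

Let p_dist v u w : p (u - w) <= p (u - v) + p (v - w).
Proof. by rewrite (le_trans _ (pD _ _))// addrA subrK. Qed.

(** Uniqueness half of extension by density. [L] carries a bare size function [p] because it will be
    a Hilbert space with [nm] or a C*-algebra with [cnorm]. *)
Lemma dense_eq0 (W : lmodType R[i]) (q : W -> R) (F : L -> W) (M : R) :
  (forall w, q w <= 0 -> w = 0) -> 0 <= M -> linear F ->
  (forall v, q (F v) <= M * p v) -> (forall x, F (phi x) = 0) ->
  forall v, F v = 0.
Proof.
move=> q0 M0 Fl FM F0 v; apply: q0; apply: ler_eps => e e0.
have M1 : 0 < M + 1 by rewrite ltr_wpDl.
have [t ht] := phi_dense v (divr_gt0 e0 M1).
have -> : F v = F (v - ev phi t).
  pose G := mkLinear Fl; rewrite -[F]/(G : L -> W) linearB.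
  rewrite [X in _ - X](ev_linear _ _ Fl) /ev big1 ?subr0// => x _.
  by rewrite /= F0 scaler0.
rewrite add0r (le_trans (FM _))// (le_trans (ler_wpM2l M0 (ltW ht)))//.
by rewrite mulrA ler_pdivrMr// mulrC ler_wpM2l ?lerDl// ltW.
Qed.

(** The bound on formal combinations contains well-definedness. The graph [G] of the extension is
    described by inequalities against all combinations instead of by limits, so that linearity
    follows from uniqueness. *)
Lemma extension (W : completeNormedModType R[i]) (psi : X -> W) (M : R) :
  0 <= M -> (forall t, nm (ev psi t) <= M * p (ev phi t)) ->
  exists2 T : {linear L -> W}, (forall x, T (phi x) = psi x) &
                               (forall v, nm (T v) <= M * p v).
Proof.
move=> M0 psiM.
pose G v w := forall t, nm (w - ev psi t) <= M * p (v - ev phi t).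
have Gphi s : G (ev phi s) (ev psi s) by move=> t; rewrite -!ev_sub.
have small e : 0 < e -> M * (e / (M + 1)) <= e.
  move=> e0; have M1 : 0 < M + 1 by rewrite ltr_wpDl.
  by rewrite mulrA ler_pdivrMr// mulrC ler_wpM2l ?lerDl// ltW.
have Gex v : exists w, G v w.
  have /choice[t tP] (n : nat) : exists t, p (v - ev phi t) < n.+1%:R^-1 / (M + 1).
    by apply: phi_dense; rewrite divr_gt0 ?invr_gt0 ?ltr_wpDl.
  have Mt n : M * p (v - ev phi (t n)) <= n.+1%:R^-1.
    by rewrite (le_trans _ (small _ _)) ?invr_gt0// ler_wpM2l// ltW.
  have [w wP] : exists w, converges (@nm R W) (fun n => ev psi (t n)) w.
    apply: complete_seq; apply: le_invS_cauchy => m n.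
    rewrite -ev_sub (le_trans (psiM _))// ev_sub.
    rewrite (le_trans (ler_wpM2l M0 (p_dist v _ _)))// mulrDr lerD//.
    by rewrite pC.
  exists w => s; apply: ler_eps => e e0.
  have [N1 H1] := wP (e / 2) ltac:(lra).
  have [N2 H2] := invS_lt (e := e / 2) ltac:(lra).
  have /H1 a1 := leq_maxl N1 N2; have /H2 a2 := leq_maxr N1 N2.
  set n := maxn N1 N2 in a1 a2.
  have a3 := le_lt_trans (Mt n) a2.
  have a4 := nm_dist (ev psi (t n)) w (ev psi s); rewrite (nmBC w (ev psi (t n))) in a4.
  have a5 := Gphi (t n) s.
  have a7 := ler_wpM2l M0 (p_dist v (ev phi (t n)) (ev phi s)).
  rewrite (pC (ev phi (t n)) v) mulrDr in a7; lra.
have Guniq v w w' : G v w -> G v w' -> w = w'.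
  move=> Gw Gw'; apply/eqP; rewrite -subr_eq0; apply/eqP/nm_le0; apply: ler_eps => e e0.
  have [t ht] : exists t, p (v - ev phi t) < (e / 2) / (M + 1).
    by apply: phi_dense; rewrite divr_gt0 ?ltr_wpDl//; lra.
  have h := ler_wpM2l M0 (ltW ht); have h1 := small (e / 2) ltac:(lra).
  have := nm_dist (ev psi t) w w'; have := Gw t; have := Gw' t.
  rewrite (nmBC w'); lra.
have Glin k v v' w w' : G v w -> G v' w' -> G (k *: v + v') (k *: w + w').
  move=> Gw Gw' t; apply: ler_eps => e e0.
  (* Replacing [v] and [v'] by combinations within [e / D] costs at most M(|k| + 1)e/D on each side
     of the inequality. *)
  pose D := 2 * M * (nm k + 1) + 1.
  have k0 := nm_ge0 k.
  have D0 : 0 < D by rewrite ltr_wpDl// !mulr_ge0// addr_ge0.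
  have eD : 0 < e / D by rewrite divr_gt0.
  have [s hs] := phi_dense v eD; have [s' hs'] := phi_dense v' eD.
  pose r := fscale k s ++ s'.
  have er (Z : lmodType R[i]) (f : X -> Z) : ev f r = k *: ev f s + ev f s'.
    by rewrite ev_cat ev_scale.
  have split (Z : lmodType R[i]) (a b c d : Z) :
      k *: a + b - (k *: c + d) = k *: (a - c) + (b - d).
    by rewrite scalerBr opprD addrACA.
  rewrite (le_trans (nm_dist (ev psi r) _ _))// er split.
  have h1 := nmD (k *: (w - ev psi s)) (w' - ev psi s'); rewrite nmZ in h1.
  have h2 := Gphi r t; rewrite !er in h2.
  have h3 := p_dist (k *: v + v') (ev phi r) (ev phi t).
  rewrite er (pC _ (k *: v + v')) split in h3.
  have h4 := pD (k *: (v - ev phi s)) (v' - ev phi s'); rewrite pZ in h4.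
  have h5 := ler_wpM2l k0 (ltW hs).
  have h6 := ler_wpM2l k0 (Gw s).
  have h7 := Gw' s'.
  have h8 : M * (nm k * p (v - ev phi s) + p (v' - ev phi s')) <=
            M * (nm k * (e / D) + e / D) by rewrite ler_wpM2l// lerD// ltW.
  have h9 := ler_wpM2l M0 h3; have h10 := ler_wpM2l M0 h4.
  have h11 : D * (e / D) = e by field; rewrite gt_eqF.
  rewrite /D in h11; lra.
have /choice[T TP] := Gex.
have Tlin : linear T.
  by move=> k v v'; apply: Guniq (TP _) _; apply: Glin.
exists (mkLinear Tlin) => [x|v].
  apply: Guniq (TP _) _; rewrite -(ev1 psi) -{1}(ev1 phi); exact: Gphi.
by have := TP v [::]; rewrite !ev_nil !subr0.
Qed.
End Extension.

Section RepOnFamily.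
Variables (R : realType) (E : cstarType R) (L : hilbertType R).
Variables (X : Type) (phi : X -> L) (alpha : E -> X -> X).
Hypothesis phi_dense :
  forall v (e : R), 0 < e -> exists t, nm (v - ev phi t) < e.
Hypothesis alpha_star : forall a x y,
  ip (phi (alpha a x)) (phi y) = ip (phi x) (phi (alpha (star a) y)).
Hypothesis alpha_linear : forall (k : R[i]) a b x,
  phi (alpha (k *: a + b) x) = k *: phi (alpha a x) + phi (alpha b x).
Hypothesis alphaM : forall a b x, phi (alpha (a * b) x) = phi (alpha a (alpha b x)).

Let dense0 (W : lmodType R[i]) (q : W -> R) (F : L -> W) (M : R) :=
  @dense_eq0 R L (@nm R L) X phi phi_dense W q F M.

(** The relations on points carry over to formal combinations, where [star_action_contractive]
    applies; its bound is the hypothesis of [extension]. *)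
Lemma rep_on_family : exists pi : starRep E L, forall a x, pi a (phi x) = phi (alpha a x).
Proof.
have bnd a t : nm (ev phi (fmap (alpha a) t)) <= cnorm a * nm (ev phi t).
  apply: (@star_action_contractive R E L _ (ev phi) (fun a => fmap (alpha a))).
  - move=> b v w; rewrite /ev !ip_suml; rewrite !big_map; apply: eq_bigr => r _.
    rewrite !ip_sumr; apply: eq_bigr => r' _ /=.
    by rewrite !(ipZl, ipZr) alpha_star.
  - move=> k b c v; rewrite /ev !big_map scaler_sumr -big_split.
    apply: eq_bigr => r _ /=.
    by rewrite alpha_linear scalerDr !scalerA mulrC.
  - move=> b c v; rewrite /ev !big_map; apply: eq_bigr => r _ /=.
    by rewrite alphaM.
have /choice[T TP] a : exists T : {linear L -> L},
    (forall x, T (phi x) = phi (alpha a x)) /\ (forall v, nm (T v) <= cnorm a * nm v).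
  have [|t|T T1 T2] := @extension R L (@nm R L) (@nmD R L) (@nmZ R L) X phi
     phi_dense L (phi \o alpha a) (cnorm a).
  - exact: cnorm_ge0.
  - by rewrite -ev_fmap.
  - by exists T.
have T1 a := (TP a).1; have T2 a := (TP a).2.
have Tc a : continuous (T a) by exact: bounded_continuous (T2 a).
have Tlin (k : R[i]) (a b : E) (x : L) : T (k *: a + b) x = k *: T a x + T b x.
  apply/eqP; rewrite -subr_eq0; apply/eqP.
  pose F y := T (k *: a + b) y - (k *: T a y + T b y).
  apply: (@dense0 L (@nm R L) F
    (cnorm (k *: a + b) + (nm k * cnorm a + cnorm b)) (@nm_le0 R L)).
  - by rewrite !addr_ge0 ?mulr_ge0 ?cnorm_ge0 ?nm_ge0.
  - move=> l u v; rewrite /F !linearP/=.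
    by rewrite [X in _ + X]addrACA -scalerDr addrACA -scalerDr.
  - move=> v; rewrite (le_trans (nmB _ _))// mulrDl lerD ?T2//.
    rewrite (le_trans (nmD _ _))// nmZ mulrDl -mulrA lerD ?T2// ler_wpM2l ?nm_ge0//.
  - by move=> y; rewrite /F !T1 alpha_linear subrr.
have TM (a b : E) (x : L) : T (a * b) x = T a (T b x).
  apply/eqP; rewrite -subr_eq0; apply/eqP.
  apply: (@dense0 L (@nm R L) (fun y => T (a * b) y - T a (T b y))
    (cnorm (a * b) + cnorm a * cnorm b) (@nm_le0 R L)).
  - by rewrite !addr_ge0 ?mulr_ge0 ?cnorm_ge0.
  - by move=> l u v; rewrite !linearP/= scalerDr addrACA.
  - move=> v; rewrite (le_trans (nmB _ _))// mulrDl lerD ?T2//.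
    by rewrite (le_trans (T2 _ _))// -mulrA ler_wpM2l ?cnorm_ge0.
  - by move=> y; rewrite !T1 alphaM subrr.
(* Density is used first in the second vector, in which the inner product is antilinear; conjugating
   both sides makes them linear. *)
have TS0 (a : E) (u : X) (y : L) : ip (T a (phi u)) y = ip (phi u) (T (star a) y).
  rewrite ipC [RHS]ipC; congr (Num.conj _).
  apply/eqP; rewrite -subr_eq0; apply/eqP.
  apply: (@dense0 R[i] (@nm R R[i])
    (fun y => ip y (T a (phi u)) - ip (T (star a) y) (phi u))
    (nm (T a (phi u)) + cnorm a * nm (phi u)) (@nm_le0 R R[i])).
  - by rewrite !addr_ge0 ?mulr_ge0 ?cnorm_ge0 ?nm_ge0.
  - by move=> l v w; rewrite !linearP/= !(ipDl, ipZl) [l *: _]mulrBr opprD addrACA.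
  - move=> v; rewrite (le_trans (nmB _ _))// mulrDl lerD//.
      by rewrite mulrC cauchy_schwarz.
    rewrite (le_trans (cauchy_schwarz _ _))// mulrAC ler_wpM2r ?nm_ge0//.
    by rewrite -(cnorm_starE a).
  - by move=> v; rewrite !T1 ipC alpha_star -ipC subrr.
have TS (a : E) (x y : L) : ip (T a x) y = ip x (T (star a) y).
  apply/eqP; rewrite -subr_eq0; apply/eqP.
  apply: (@dense0 R[i] (@nm R R[i]) (fun x => ip (T a x) y - ip x (T (star a) y))
    (cnorm a * nm y + nm (T (star a) y)) (@nm_le0 R R[i])).
  - by rewrite !addr_ge0 ?mulr_ge0 ?cnorm_ge0 ?nm_ge0.
  - by move=> l v w; rewrite !linearP/= !(ipDl, ipZl) [l *: _]mulrBr opprD addrACA.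
  - move=> v; rewrite (le_trans (nmB _ _))// mulrDl lerD//; last first.
      by rewrite mulrC cauchy_schwarz.
    by rewrite (le_trans (cauchy_schwarz _ _))// mulrAC ler_wpM2r ?nm_ge0.
  - by move=> v; rewrite TS0 subrr.
by exists (StarRep Tc Tlin TM TS).
Qed.
End RepOnFamily.

(** * Representations of completed tensor products *)

Section OperatorNorm.
Variables (R : realType) (H : hilbertType R) (T : {linear H -> H}).

Lemma opnorm_le (M : R) : (opnorm T <= M%:E)%E -> forall x, nm (T x) <= M * nm x.
Proof.
move=> TM x; have [->|x0] := eqVneq x 0; first by rewrite linear0 !nm0 mulr0.
have xp : 0 < nm x.
  by rewrite lt_def nm_ge0 andbT; apply: contra_neq x0; exact: nm_eq0.
have /ereal_sup_ubound : [set (complex.Re `|T x|)%:E | x in [set x : H | `|x| <= 1]]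
    (nm (T ((nm x)^-1%:C *: x)))%:E.
  exists ((nm x)^-1%:C *: x) => //=.
  rewrite nmE nmZ nm_real ger0_norm ?invr_ge0 ?(ltW xp)// mulVf ?gt_eqF//.
move=> /le_trans/(_ TM); rewrite lee_fin linearZ/= nmZ nm_real.
by rewrite ger0_norm ?invr_ge0 ?(ltW xp)// mulrC ler_pdivrMr.
Qed.
End OperatorNorm.

Lemma rep_pair_max_norm (R : realType) (B D : cstarType R) (H : hilbertType R)
  (pi : starRep B H) (rho : starRep D H) (t : seq (B * D)) (M : R) :
  (forall b d x, pi b (rho d x) = rho d (pi b x)) ->
  max_norm t = M%:E ->
  forall x, nm (\sum_(p <- t) pi p.1 (rho p.2 x)) <= M * nm x.
Proof.
move=> C tM; pose T x := \sum_(p <- t) pi p.1 (rho p.2 x).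
have Tl : linear T.
  move=> k x y; rewrite /T scaler_sumr -big_split.
  by apply: eq_bigr => p _; rewrite !linearP.
apply: (@opnorm_le R H (mkLinear Tl)).
by rewrite -tM; apply: ereal_sup_ubound; exists H, pi, rho.
Qed.

(* max_norm and min_norm are defined on sums of elementary tensors: coefficients
   are absorbed into the first factor. *)
Definition unscale (R : realType) (B D : cstarType R) (t : seq (R[i] * (B * D))) :=
  [seq (p.1 *: p.2.1, p.2.2) | p <- t].

Section TensorCompletion.
Variables (R : realType) (B D A : cstarType R) (N : seq (B * D) -> \bar R).
Variables (iB : {lrmorphism B -> A}) (iD : {lrmorphism D -> A}).
Hypothesis hA : @tensor_completion R B D A N iB iD.

Definition elem (p : B * D) : A := iB p.1 * iD p.2.

Lemma tensor_starB b : iB (star b) = star (iB b). Proof. by case: hA => -[]. Qed.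
Lemma tensor_starD d : iD (star d) = star (iD d). Proof. by case: hA => -[]. Qed.
Lemma tensor_comm b d : iB b * iD d = iD d * iB b. Proof. by case: hA. Qed.

Lemma ev_unscale t : ev elem t = \sum_(p <- unscale t) iB p.1 * iD p.2.
Proof.
by rewrite big_map; apply: eq_bigr => p _ /=; rewrite linearZ/= -scalerAl.
Qed.

Lemma tensor_norm t : N (unscale t) = (cnorm (ev elem t))%:E.
Proof. by case: hA => _ _ <- _; rewrite ev_unscale. Qed.

Lemma tensor_dense a (e : R) : 0 < e -> exists t, cnorm (a - ev elem t) < e.
Proof.
move=> e0; case: hA => _ _ _ /(_ a e e0)[t ht].
exists [seq (1, p) | p <- t]; rewrite /ev big_map.
by under eq_bigr do rewrite scale1r.
Qed.

Lemma elem_star b d : star (elem (b, d)) = elem (star b, star d).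
Proof. by rewrite /elem/= starM -tensor_starB -tensor_starD tensor_comm. Qed.

Lemma elemM b d b' d' : elem (b, d) * elem (b', d') = elem (b * b', d * d').
Proof.
rewrite /elem/= !rmorphM -!mulrA; congr (_ * _).
by rewrite !mulrA tensor_comm.
Qed.

Lemma elem1 : elem (1, 1) = 1.
Proof. by rewrite /elem/= !rmorph1 mulr1. Qed.
End TensorCompletion.

Section RepOnCompletion.
Variables (R : realType) (B D A : cstarType R) (N : seq (B * D) -> \bar R).
Variables (iB : {lrmorphism B -> A}) (iD : {lrmorphism D -> A}).
Hypothesis hA : @tensor_completion R B D A N iB iD.
Variables (H : hilbertType R) (psi : B * D -> H -> H).
Hypothesis psi_linear : forall p, linear (psi p).
Hypothesis psi_star : forall b d x y,
  ip (psi (b, d) x) y = ip x (psi (star b, star d) y).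
Hypothesis psiM : forall b d b' d' x,
  psi (b * b', d * d') x = psi (b, d) (psi (b', d') x).
Hypothesis psi_bound : forall t x,
  nm (ev (fun p => psi p x) t) <= cnorm (ev (elem iB iD) t) * nm x.

Let cnZ' (k : R[i]) (a : A) : cnorm (k *: a) = nm k * cnorm a := cnZ k a.

Let dense0 (W : lmodType R[i]) (q : W -> R) (F : A -> W) (M : R) :=
  @dense_eq0 R A (@cnorm R A) (B * D) (elem iB iD)
    (@tensor_dense _ _ _ _ _ _ _ hA) W q F M.

(** For each fixed vector [x] the orbit map a |-> a x is extended from elementary tensors to [A];
    the axioms of a representation then follow by density in [A]. The choice of [N] enters only
    through [psi_bound]. *)
Lemma rep_on_completion : exists pi : starRep A H,
  forall b d x, pi (iB b * iD d) x = psi (b, d) x.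
Proof.
have /choice[T TP] x : exists T : {linear A -> H},
    (forall p, T (elem iB iD p) = psi p x) /\ (forall a, nm (T a) <= nm x * cnorm a).
  have [|t|T T1 T2] := @extension R A (@cnorm R A) (@cnormD R A) cnZ' (B * D)
    (elem iB iD) (@tensor_dense _ _ _ _ _ _ _ hA) H (fun p => psi p x) (nm x).
  - exact: nm_ge0.
  - by rewrite mulrC.
  - by exists T.
have T1 x := (TP x).1; have T2 x := (TP x).2.
have Tl a : linear (T^~ a).
  move=> k x y; apply/eqP; rewrite -subr_eq0; apply/eqP.
  apply: (@dense0 H (@nm R H) (fun a => T (k *: x + y) a - (k *: T x a + T y a))
    (nm (k *: x + y) + (nm k * nm x + nm y)) (@nm_le0 R H)).
  - by rewrite !addr_ge0 ?mulr_ge0 ?nm_ge0.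
  - move=> l u v; rewrite !linearP/=.
    by rewrite [X in _ + X]addrACA -scalerDr addrACA -scalerDr.
  - move=> v; rewrite (le_trans (nmB _ _))// mulrDl lerD ?T2//.
    rewrite (le_trans (nmD _ _))// nmZ mulrDl -mulrA lerD ?T2// ler_wpM2l ?nm_ge0//.
  - by move=> p; rewrite !T1 psi_linear subrr.
pose pi a : {linear H -> H} := mkLinear (Tl a).
have piE a x : pi a x = T x a by [].
have pi2 a x : nm (pi a x) <= cnorm a * nm x by rewrite piE mulrC T2.
have pi_c a : continuous (pi a) by exact: bounded_continuous (pi2 a).
have pi_l (k : R[i]) (a b : A) x : pi (k *: a + b) x = k *: pi a x + pi b x.
  by rewrite !piE linearP.
(* Multiplicativity is extended one factor at a time; here the left factor is still an elementary
   tensor. *)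
have pi_M0 p b x : pi (elem iB iD p * b) x = pi (elem iB iD p) (pi b x).
  apply/eqP; rewrite -subr_eq0; apply/eqP.
  apply: (@dense0 H (@nm R H)
    (fun b => pi (elem iB iD p * b) x - pi (elem iB iD p) (pi b x))
    (cnorm (elem iB iD p) * nm x + cnorm (elem iB iD p) * nm x) (@nm_le0 R H)).
  - by rewrite !addr_ge0 ?mulr_ge0 ?nm_ge0 ?cnorm_ge0.
  - move=> l u v; rewrite mulrDr -scalerAr !pi_l linearP/=.
    by rewrite scalerBr opprD addrACA.
  - move=> v; rewrite (le_trans (nmB _ _))// mulrDl lerD//.
      by rewrite (le_trans (pi2 _ _))// mulrAC ler_wpM2r ?nm_ge0 ?cnormM.
    by rewrite (le_trans (pi2 _ _))// -mulrA ler_wpM2l ?cnorm_ge0// mulrC.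
  - case: p => b' d' [b'' d'']; rewrite (elemM hA) !piE !T1 psiM subrr//.
have pi_M (a b : A) x : pi (a * b) x = pi a (pi b x).
  apply/eqP; rewrite -subr_eq0; apply/eqP.
  apply: (@dense0 H (@nm R H) (fun a => pi (a * b) x - pi a (pi b x))
    (cnorm b * nm x + cnorm b * nm x) (@nm_le0 R H)).
  - by rewrite !addr_ge0 ?mulr_ge0 ?nm_ge0 ?cnorm_ge0.
  - by move=> l u v; rewrite mulrDl -scalerAl !pi_l scalerBr opprD addrACA.
  - move=> v; rewrite (le_trans (nmB _ _))// mulrDl lerD//.
      rewrite (le_trans (pi2 _ _))// mulrAC ler_wpM2r ?nm_ge0//.
      by rewrite mulrC cnormM.
    by rewrite (le_trans (pi2 _ _))// mulrC ler_wpM2r ?cnorm_ge0.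
  - by move=> p; rewrite pi_M0 subrr.
have pi_S (a : A) x y : ip (pi a x) y = ip x (pi (star a) y).
  apply/eqP; rewrite -subr_eq0; apply/eqP.
  apply: (@dense0 R[i] (@nm R R[i]) (fun a => ip (pi a x) y - ip x (pi (star a) y))
    (nm x * nm y + nm x * nm y) (@nm_le0 R R[i])).
  - by rewrite !addr_ge0 ?mulr_ge0 ?nm_ge0 ?cnorm_ge0.
  - move=> l u v; rewrite starD starZ !pi_l !(ipDl, ipZl) !(ipDr, ipZr).
    by rewrite cconjK [l *: _]mulrBr opprD addrACA.
  - move=> v; rewrite (le_trans (nmB _ _))// mulrDl lerD//.
      rewrite (le_trans (cauchy_schwarz _ _))// mulrAC ler_wpM2r ?nm_ge0//.
      by rewrite mulrC.
    rewrite (le_trans (cauchy_schwarz _ _))// -mulrA ler_wpM2l ?nm_ge0//.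
    by rewrite mulrC -(cnorm_starE v).
  - by move=> [b d]; rewrite (elem_star hA) !piE !T1 psi_star subrr.
exists (StarRep pi_c pi_l pi_M pi_S) => b d x.
by rewrite -(T1 x (b, d)).
Qed.
End RepOnCompletion.

(** The pair [l], [r] is among those over which [max_norm] takes its supremum, and this supremum is
    finite because it equals a norm in [M]. Unitality of the two actions gives nondegeneracy. *)
Lemma bimod_lract_max (R : realType) (E : cstarType R) (H : hilbertType R)
  (l : starRep E H) (r : starRep (E^c)%type H)
  (l1 : forall x, l 1 x = x) (r1 : forall x, r 1 x = x)
  (lrC : forall a b x, l a (r b x) = r b (l a x))
  (M : cstarType R) (iL : {lrmorphism E -> M}) (iR : {lrmorphism (E^c)%type -> M}) :
  max_tensor iL iR ->
  exists2 pi : starRep M H, Defs.nondegenerate pi &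
    forall a b x, pi (iL a * iR b) x = r b (l a x).
Proof.
move=> hM.
have [pi piE] : exists pi : starRep M H, forall a b x, pi (iL a * iR b) x = r b (l a x).
  apply: (@rep_on_completion R E (E^c)%type M _ iL iR hM H
    (fun p x => r p.2 (l p.1 x))).
  - by move=> p k x y; rewrite !linearP.
  - by move=> a b x y /=; rewrite !rep_ip lrC.
  - by move=> a b a' b' x /=; rewrite !repM lrC.
  - move=> t x; have := tensor_norm hM t.
    move=> /(rep_pair_max_norm lrC)/(_ x); rewrite /unscale big_map.
    congr (nm _ <= _); apply: eq_bigr => p _ /=.
    by rewrite repZ lrC.
exists pi => //.
have pi1 x : pi 1 x = x by rewrite -(elem1 iL iR) /elem/= piE l1 r1.
move=> O [x Ox] _; exists x; split=> //.
exists [:: (1, x)]; last by rewrite big_seq1 scale1r.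
by move=> p; rewrite inE => /eqP ->; exists 1, x; rewrite pi1.
Qed.

Definition mkBimod (R : realType) (E : cstarType R) (H : hilbertType R)
  (l : starRep E H) (r : starRep (E^c)%type H) l1 r1 lrC : hilbertBimod E :=
  @HilbertBimod R E H l r l1 r1 lrC (@bimod_lract_max R E H l r l1 r1 lrC).

(** * Hilbert spaces of positive definite kernels *)

(** Antilinear extension of [f] from points to formal combinations. *)
Definition pairing (R : realType) (X : Type) (f : X -> R[i]) (t : seq (R[i] * X)) : R[i] :=
  \sum_(p <- t) Num.conj p.1 * f p.2.

(** The function that the combination [t] represents in the reproducing kernel space. *)
Definition frep (R : realType) (X : Type) (k : X -> X -> R[i]) (t : seq (R[i] * X)) :
  X -> R[i] := fun y => \sum_(p <- t) p.1 * k p.2 y.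

(** Positivity constrains only the real part, since Hermitian symmetry makes the quadratic form real
    ([bilxx]). *)
Record kernel (R : realType) (X : Type) := Kernel {
  ker :> X -> X -> R[i];
  kerC : forall x y, ker x y = Num.conj (ker y x);
  ker_pos : forall t, 0 <= complex.Re (pairing (frep ker t) t) }.

Section Kernels.
Variables (R : realType) (X : Type) (k : kernel R X).
Implicit Types (f g : X -> R[i]) (s t : seq (R[i] * X)) (a : R[i]).

Definition bil s t := pairing (frep k s) t.
Definition qf t : R := complex.Re (bil t t).

Lemma pairD f g t : pairing (f + g) t = pairing f t + pairing g t.
Proof. by rewrite /pairing -big_split; apply: eq_bigr => p _; rewrite [LHS]mulrDr. Qed.

Lemma pairZ a f t : pairing (a *: f) t = a * pairing f t.
Proof.
rewrite /pairing mulr_sumr; apply: eq_bigr => p _.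
by rewrite mulrCA.
Qed.

Lemma pairB f g t : pairing (f - g) t = pairing f t - pairing g t.
Proof. by rewrite -scaleN1r pairD pairZ mulN1r. Qed.

Lemma pair_cat f s t : pairing f (s ++ t) = pairing f s + pairing f t.
Proof. exact: big_cat. Qed.

Lemma pair_scale f a t : pairing f (fscale a t) = Num.conj a * pairing f t.
Proof.
rewrite /pairing big_map mulr_sumr; apply: eq_bigr => p _ /=.
by rewrite cconjM mulrA.
Qed.

Lemma pair1 f x : pairing f [:: (1, x)] = f x.
Proof. by rewrite /pairing big_seq1 rmorph1 mul1r. Qed.

Lemma frep_cat s t : frep k (s ++ t) = frep k s + frep k t.
Proof. by apply/funext => y; rewrite /frep big_cat. Qed.

Lemma frep_scale a t : frep k (fscale a t) = a *: frep k t.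
Proof.
apply/funext => y; rewrite /frep big_map [RHS]mulr_sumr; apply: eq_bigr => p _ /=.
by rewrite mulrA.
Qed.

Lemma bilC s t : bil s t = Num.conj (bil t s).
Proof.
rewrite /bil /pairing /frep cconj_sum.
transitivity (\sum_(p <- t) \sum_(r <- s) Num.conj p.1 * (r.1 * k r.2 p.2)).
  by apply: eq_bigr => p _; rewrite mulr_sumr.
rewrite exchange_big; apply: eq_bigr => r _ /=.
rewrite cconjM cconjK cconj_sum mulr_sumr; apply: eq_bigr => p _.
by rewrite cconjM -kerC mulrCA.
Qed.

Lemma qf_ge0 t : 0 <= qf t. Proof. exact: ker_pos. Qed.

Lemma bilxx t : bil t t = (qf t)%:C.
Proof.
have := bilC t t; rewrite /qf; case: (bil t t) => a b [] /eqP.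
by rewrite -addr_eq0 -mulr2n mulrn_eq0/= => /eqP ->.
Qed.

Lemma qf_addscale a s t : qf (s ++ fscale a t) =
  qf s + 2 * complex.Re (Num.conj a * bil s t) + nm a ^+ 2 * qf t.
Proof.
rewrite {1}/qf /bil frep_cat frep_scale !pairD !pair_cat !pairZ !pair_scale.
rewrite -!/(bil _ _) !ReD mulrA conjC_mul !bilxx -rmorphM/=.
have -> : complex.Re (a * bil t s) = complex.Re (Num.conj a * bil s t).
  by rewrite [bil s t]bilC -cconjM cRe_conj.
ring.
Qed.

Lemma bil_cs s t : nm (bil s t) <= Num.sqrt (qf s) * Num.sqrt (qf t).
Proof.
rewrite -sqrtrM ?qf_ge0// -(@ler_pXn2r _ 2)// ?nnegrE ?nm_ge0 ?sqrtr_ge0//.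
rewrite sqr_sqrtr ?mulr_ge0 ?qf_ge0//; apply: quadratic_discr; first exact: qf_ge0.
move=> l; have := qf_ge0 (s ++ fscale (Num.conj l) t).
by rewrite qf_addscale nm_conj cconjK.
Qed.

Definition bounded f (M : R) := 0 <= M /\ forall t, nm (pairing f t) <= M * Num.sqrt (qf t).

Definition mem_rkhs : {pred X -> R[i]} := fun f => `[< exists M, bounded f M >].

Lemma mem_rkhsP f : reflect (exists M, bounded f M) (f \in mem_rkhs).
Proof. exact: asboolP. Qed.

Lemma boundedD f g M M' : bounded f M -> bounded g M' -> bounded (f + g) (M + M').
Proof.
move=> [M0 fM] [M'0 gM]; split=> [|t]; first exact: addr_ge0.
by rewrite pairD (le_trans (nmD _ _))// mulrDl lerD.
Qed.

Lemma boundedZ a f M : bounded f M -> bounded (a *: f) (nm a * M).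
Proof.
move=> [M0 fM]; split=> [|t]; first by rewrite mulr_ge0 ?nm_ge0.
by rewrite pairZ nmM -mulrA ler_wpM2l ?nm_ge0.
Qed.

Lemma bounded0 : bounded 0 0.
Proof.
split=> // t; rewrite /pairing big1 ?nm0 ?mul0r// => p _; exact: mulr0.
Qed.

Lemma mem_rkhs_submod : submod_closed mem_rkhs.
Proof.
split; first by apply/mem_rkhsP; exists 0; exact: bounded0.
move=> a f g /mem_rkhsP[M fM] /mem_rkhsP[M' gM]; apply/mem_rkhsP.
by exists (nm a * M + M'); apply: boundedD => //; exact: boundedZ.
Qed.

HB.instance Definition _ :=
  GRing.isSubmodClosed.Build R[i] (X -> R[i])%type mem_rkhs mem_rkhs_submod.

(* The reproducing kernel Hilbert space of k, realised as the space of bounded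
   antilinear functionals on formal combinations of points of X. *)
Record rkhs := Rkhs { rval : X -> R[i]; rvalP : rval \in mem_rkhs }.

HB.instance Definition _ := [isSub for rval].
HB.instance Definition _ := [Choice of rkhs by <:].
HB.instance Definition _ := [SubChoice_isSubLmodule of rkhs by <:].

Definition rnorm (f : rkhs) : R := inf [set M | bounded (rval f) M].

Lemma bounded_has_inf (f : rkhs) : has_inf [set M | bounded (rval f) M].
Proof.
split; first by have /mem_rkhsP[M fM] := rvalP f; exists M.
by exists 0 => M [].
Qed.

Lemma rnorm_le (f : rkhs) M : bounded (rval f) M -> rnorm f <= M.
Proof. by move=> fM; apply: ge_inf => //; case: (bounded_has_inf f). Qed.

Lemma rnorm_ge0 (f : rkhs) : 0 <= rnorm f.
Proof. by apply: lb_le_inf; [case: (bounded_has_inf f)|move=> M []]. Qed.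

(** The infimum of the bounds is itself a bound. If [t] has seminorm 0, any bound already makes the
    pairing vanish; otherwise one divides by the seminorm. *)
Lemma rnorm_bound (f : rkhs) t : nm (pairing (rval f) t) <= rnorm f * Num.sqrt (qf t).
Proof.
have := sqrtr_ge0 (qf t); rewrite le_eqVlt => /predU1P[q0|q0].
  have /mem_rkhsP[M [_ /(_ t)]] := rvalP f.
  by rewrite -q0 !mulr0.
rewrite -ler_pdivrMr//; apply: lb_le_inf; first by case: (bounded_has_inf f).
by move=> M [_ /(_ t)]; rewrite ler_pdivrMr.
Qed.

Lemma rnorm_bounded (f : rkhs) : bounded (rval f) (rnorm f).
Proof. by split; [exact: rnorm_ge0|exact: rnorm_bound]. Qed.

Lemma rnormD (f g : rkhs) : (rnorm (f + g))%:C <= (rnorm f)%:C + (rnorm g)%:C.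
Proof.
rewrite -rmorphD lecR; apply: rnorm_le.
have -> : rval (f + g) = rval f + rval g by [].
by apply: boundedD; exact: rnorm_bounded.
Qed.

Lemma rnormZ_le a (f : rkhs) : rnorm (a *: f) <= nm a * rnorm f.
Proof.
apply: rnorm_le.
have -> : rval (a *: f) = a *: rval f by [].
by apply: boundedZ; exact: rnorm_bounded.
Qed.

Lemma rnormZ a (f : rkhs) : (rnorm (a *: f))%:C = `|a| * (rnorm f)%:C.
Proof.
rewrite nmE -rmorphM; congr (_%:C); apply/eqP; rewrite eq_le rnormZ_le/=.
have [->|a0] := eqVneq a 0; first by rewrite nm0 mul0r rnorm_ge0.
have na0 : 0 < nm a by rewrite lt_def nm_ge0 andbT; apply: contra_neq a0; exact: nm_eq0.
rewrite -{1}[f](scalerK a0) mulrC -ler_pdivlMr// mulrC.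
rewrite (le_trans (rnormZ_le _ _))//.
by rewrite nmV.
Qed.

Lemma rnorm_eq0 (f : rkhs) : (rnorm f)%:C = 0 -> f = 0.
Proof.
move=> /complexI f0; apply: val_inj; apply/funext => y.
suff : rval f y = 0 by [].
apply: nm_le0.
by have := rnorm_bound f [:: (1, y)]; rewrite pair1 f0 mul0r.
Qed.

HB.instance Definition _ := Lmodule_isNormed.Build R[i] rkhs rnormD rnormZ rnorm_eq0.

Definition pr (f : rkhs) t : R[i] := pairing (rval f) t.

Lemma nm_rkhsE (f : rkhs) : nm f = rnorm f. Proof. by []. Qed.

Lemma prD (f g : rkhs) t : pr (f + g) t = pr f t + pr g t.
Proof. by rewrite -pairD. Qed.

Lemma prZ a (f : rkhs) t : pr (a *: f) t = a * pr f t.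
Proof. by rewrite -pairZ. Qed.

Lemma prB (f g : rkhs) t : pr (f - g) t = pr f t - pr g t.
Proof. by rewrite -scaleN1r prD prZ mulN1r. Qed.

Lemma converges_pair (u : nat -> X -> R[i]) f :
  (forall y, converges (@nm R R[i]) (u^~ y) (f y)) ->
  forall t, converges (@nm R R[i]) (fun n => pairing (u n) t) (pairing f t).
Proof.
move=> uf; elim=> [|p t IH] e e0.
  by exists 0%N => n _; rewrite /pairing !big_nil subrr nm0.
have p1 : 0 < nm p.1 + 1 by rewrite ltr_wpDl ?nm_ge0.
have [N1 H1] := uf p.2 (e / 2 / (nm p.1 + 1)) ltac:(by rewrite !divr_gt0).
have [N2 H2] := IH (e / 2) ltac:(by rewrite divr_gt0).
exists (maxn N1 N2) => n; rewrite geq_max => /andP[/H1 h1 /H2 h2].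
rewrite /pairing !big_cons -/(pairing _ t) -/(pairing f t) opprD addrACA -mulrBr.
rewrite (le_lt_trans (nmD _ _))// nmM nm_conj [e]splitr ler_ltD//.
rewrite ltr_pdivlMr// in h1; rewrite (le_trans _ (ltW h1))// mulrC.
by rewrite ler_wpM2l ?nm_ge0// lerDl.
Qed.

(** Evaluation at a point is bounded, so a Cauchy sequence converges pointwise; letting m tend to
    infinity in the bound for u_n - u_m shows that the pointwise limit is a limit in norm. *)
Lemma rkhs_complete_seq (u : nat -> rkhs) :
  cauchy_seq (@nm R rkhs) u -> exists l, converges (@nm R rkhs) u l.
Proof.
move=> uc.
have /choice[f fP] y : exists z, converges (@nm R R[i]) (fun n => rval (u n) y) z.
  apply: complete_seq_complex => e e0; set c := Num.sqrt (qf [:: (1, y)]).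
  have c1 : 0 < c + 1 by rewrite ltr_wpDl ?sqrtr_ge0.
  have [N HN] := uc (e / (c + 1)) (divr_gt0 e0 c1); exists N => m n Nm Nn.
  have := rnorm_bound (u m - u n) [:: (1, y)]; rewrite pair1 => /le_lt_trans; apply.
  have := HN m n Nm Nn; rewrite nm_rkhsE ltr_pdivlMr// => /(le_lt_trans _); apply.
  by rewrite ler_wpM2l ?rnorm_ge0// lerDl.
have fb e : 0 < e -> exists N : nat, forall n : nat, (N <= n)%N ->
    bounded (rval (u n) - f) e.
  move=> e0; have [N HN] := uc e e0; exists N => n Nn; split=> [|t]; first exact: ltW.
  apply: ler_eps => d d0; have [N' HN'] := converges_pair fP t d0.
  have h1 := HN' _ (leq_maxr N N').
  have h2 := HN n _ Nn (leq_maxl N N').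
  set m := maxn N N' in h1 h2.
  have -> : rval (u n) - f = (rval (u n) - rval (u m)) + (rval (u m) - f).
    by rewrite addrA subrK.
  rewrite pairD (le_trans (nmD _ _))// lerD//; last by rewrite pairB ltW.
  rewrite (le_trans (rnorm_bound (u n - u m) t))// ler_wpM2r ?sqrtr_ge0//.
  exact: ltW.
have fm : f \in mem_rkhs.
  have [N /(_ N (leqnn N)) HN] := fb 1 ltr01.
  have -> : f = rval (u N) + (-1) *: (rval (u N) - f).
    by rewrite scaleN1r opprB addrC subrK.
  apply/mem_rkhsP; exists (rnorm (u N) + nm (-1 : R[i]) * 1).
  by apply: boundedD; [exact: rnorm_bounded|exact: boundedZ].
exists (Rkhs fm) => e e0.
have [N HN] := fb (e / 2) ltac:(by rewrite divr_gt0); exists N => n Nn.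
rewrite (@le_lt_trans _ _ (e / 2))//; last by rewrite ltr_pdivrMr// ltr_pMr// ltr1n.
by rewrite nm_rkhsE; apply: rnorm_le; exact: HN.
Qed.

HB.instance Definition _ := Uniform_isComplete.Build rkhs
  (@filter_cauchy_cvg R rkhs rkhs_complete_seq).
End Kernels.

Section KernelHilbert.
Variables (R : realType) (X : Type) (k : kernel R X).
Implicit Types (f g : rkhs k) (s t : seq (R[i] * X)) (a : R[i]).

Lemma frep_bounded s : bounded k (frep k s) (Num.sqrt (qf k s)).
Proof. by split=> [|t]; [exact: sqrtr_ge0|exact: bil_cs]. Qed.

Lemma frep_mem s : frep k s \in mem_rkhs k.
Proof. by apply/mem_rkhsP; exists (Num.sqrt (qf k s)); exact: frep_bounded. Qed.

Definition kpoint (x : X) : rkhs k := Rkhs (frep_mem [:: (1, x)]).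

Lemma rval_ev s : rval (ev kpoint s) = frep k s.
Proof.
elim: s => [|p s IH]; first by rewrite ev_nil; apply/funext => y; rewrite /frep big_nil.
rewrite ev_cons.
have -> : rval (p.1 *: kpoint p.2 + ev kpoint s) =
          p.1 *: rval (kpoint p.2) + rval (ev kpoint s) by [].
rewrite IH; apply/funext => y; rewrite /frep big_cons /=; congr (_ + _).
by rewrite /frep/= [LHS]/GRing.scale/= big_seq1 mul1r.
Qed.

Lemma pr_ev s t : pr (ev kpoint s) t = bil k s t.
Proof. by rewrite /pr rval_ev. Qed.

Lemma nm_ev s : nm (ev kpoint s) = Num.sqrt (qf k s).
Proof.
apply/eqP; rewrite eq_le nm_rkhsE rnorm_le/=; last first.
  by rewrite rval_ev; exact: frep_bounded.
have := rnorm_bound (ev kpoint s) s; rewrite -/(pr _ _) pr_ev bilxx nm_real.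
rewrite ger0_norm ?qf_ge0// -{1}(sqr_sqrtr (qf_ge0 k s)) expr2.
have [->|s0] := eqVneq (Num.sqrt (qf k s)) 0; first by rewrite rnorm_ge0.
by rewrite ler_pM2r// lt_def s0 sqrtr_ge0.
Qed.

Lemma pr_bound f t : nm (pr f t) <= nm f * nm (ev kpoint t).
Proof. by rewrite nm_ev; exact: rnorm_bound. Qed.

Lemma pr_subr f s t : pr f s - pr f t = pr f (s ++ fscale (-1) t).
Proof. by rewrite /pr pair_cat pair_scale rmorphN1 mulN1r. Qed.

(* f is approximated by near-minimisers t of |t|^2 - 2 Re f(t). *)
Lemma rkhs_dense f (e : R) : 0 < e -> exists t, nm (f - ev kpoint t) < e.
Proof.
move=> e0; pose J t := qf k t - 2 * complex.Re (pr f t).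
have Jlb t : - nm f ^+ 2 <= J t.
  have := pr_bound f t; rewrite nm_ev => h.
  have h2 := le_trans (Re_le_nm _) h.
  have h3 := sqr_ge0 (nm f - Num.sqrt (qf k t)).
  by rewrite /J -{1}(sqr_sqrtr (qf_ge0 k t)); nra.
have D0 : range J !=set0 by exists (J [::]), [::].
have Dinf : has_inf (range J).
  by split=> //; exists (- nm f ^+ 2) => _ [t _ <-].
have [|_ [t _ <-] Jt] := @inf_adherent _ (range J) ((e / 2) ^+ 2) _ Dinf.
  by rewrite exprn_gt0// divr_gt0.
exists t; rewrite (@le_lt_trans _ _ (e / 2))//; last by lra.
rewrite nm_rkhsE; apply: rnorm_le; split=> [|s]; first by lra.
rewrite -/(pr _ _) -(@ler_pXn2r _ 2)// ?nnegrE ?nm_ge0//; last first.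
  by rewrite mulr_ge0 ?sqrtr_ge0//; lra.
rewrite exprMn sqr_sqrtr ?qf_ge0//; apply: quadratic_discr; first exact: qf_ge0.
(* Moving the near-minimiser [t] by a multiple of [s] lowers [J] by at most [(e / 2) ^+ 2]; the
   discriminant criterion turns this into a bound on the residual functional at [s]. *)
move=> l; pose m : R[i] := - Num.conj l.
have := ge_inf Dinf.2 (imageT J (t ++ fscale m s)).
have nml : nm m = nm l by rewrite /m nmN nm_conj.
have ml : Num.conj m = - l by rewrite /m rmorphN; congr (- _); exact: cconjK.
have -> : J (t ++ fscale m s) = J t + 2 * complex.Re (l * pr (f - ev kpoint t) s)
            + nm l ^+ 2 * qf k s.
  rewrite /J qf_addscale nml ml /pr pair_cat pair_scale ml -/(pr f s) -/(pr f t).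
  by rewrite -/(pr (f - _) s) prB pr_ev !mulNr mulrBr !ReD !ReN; ring.
lra.
Qed.

(** The inner product with [g] is the continuous extension of the functional [pr f] from
    combinations to [g]; the inequality pins the value down independently of an approximating
    sequence. *)
Lemma kip_ex f g : exists z : R[i], forall t,
  nm (pr f t - z) <= nm f * nm (g - ev kpoint t).
Proof.
have /choice[t tP] (n : nat) : exists t, nm (g - ev kpoint t) < n.+1%:R^-1 / (nm f + 1).
  by apply: rkhs_dense; rewrite divr_gt0 ?invr_gt0// ltr_wpDl ?nm_ge0.
have ft n : nm f * nm (g - ev kpoint (t n)) <= n.+1%:R^-1.
  have f1 : 0 < nm f + 1 by rewrite ltr_wpDl ?nm_ge0.
  have := tP n; rewrite ltr_pdivlMr// => /ltW; apply: le_trans.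
  by rewrite mulrC ler_wpM2l ?nm_ge0// lerDl.
have prt s s' : nm (pr f s - pr f s') <= nm f * nm (ev kpoint s - ev kpoint s').
  by rewrite pr_subr (le_trans (pr_bound _ _))// ev_sub.
have [z zP] : exists z, converges (@nm R R[i]) (fun n => pr f (t n)) z.
  apply: complete_seq_complex; apply: le_invS_cauchy => m n.
  rewrite (le_trans (prt _ _))//.
  have := ler_wpM2l (nm_ge0 f) (nm_dist g (ev kpoint (t m)) (ev kpoint (t n))).
  rewrite mulrDr (nmBC _ g) => h; rewrite (le_trans h)// lerD//.
exists z => s; apply: ler_eps => e e0.
have [N1 H1] := zP (e / 2) ltac:(lra).
have [N2 H2] := invS_lt (e := e / 2) ltac:(lra).
have /H1 a1 := leq_maxl N1 N2; have /H2 a2 := leq_maxr N1 N2.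
set n := maxn N1 N2 in a1 a2; have a3 := le_lt_trans (ft n) a2.
have a4 := nm_dist (pr f (t n)) (pr f s) z; have a5 := prt s (t n).
have a6 := ler_wpM2l (nm_ge0 f) (nm_dist g (ev kpoint s) (ev kpoint (t n))).
rewrite mulrDr (nmBC _ g) in a6.
apply: le_trans a4 _; apply: le_trans (lerD (le_trans a5 a6) (ltW a1)) _.
rewrite -addrA lerD2l -lerBrDr (le_trans (ltW a3))//; lra.
Qed.

Definition kip f g : R[i] := sval (cid (kip_ex f g)).

Lemma kipP f g t : nm (pr f t - kip f g) <= nm f * nm (g - ev kpoint t).
Proof. exact: (svalP (cid (kip_ex f g))). Qed.

(** Testing only those [t] within distance 1 of [g] admits estimates that are Lipschitz only
    locally, such as the quadratic one in [kip_norm]. *)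
Lemma kip_uniq f g z (M : R) : 0 <= M ->
  (forall t, nm (g - ev kpoint t) <= 1 -> nm (pr f t - z) <= M * nm (g - ev kpoint t)) ->
  kip f g = z.
Proof.
move=> M0 zP; apply/eqP; rewrite -subr_eq0; apply/eqP/nm_le0; apply: ler_eps => e e0; rewrite add0r.
pose D := nm f + M + 1.
have D0 : 0 < D by rewrite ltr_wpDl// addr_ge0// nm_ge0.
have [|t] := @rkhs_dense g (Num.min 1 (e / D)).
  by rewrite lt_min ltr01 divr_gt0.
rewrite lt_min => /andP[t1 te].
have h1 := nm_dist (pr f t) (kip f g) z; have h2 := zP t (ltW t1).
have h3 := kipP f g t; rewrite (nmBC (kip f g) (pr f t)) in h1.
rewrite ltr_pdivlMr// mulrC /D in te.
have := nm_ge0 (g - ev kpoint t); lra.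
Qed.

Lemma kip_linear a f f' g : kip (a *: f + f') g = a * kip f g + kip f' g.
Proof.
apply: (@kip_uniq _ _ _ (nm a * nm f + nm f')) => [|t _].
  by rewrite addr_ge0 ?mulr_ge0 ?nm_ge0.
rewrite prD prZ opprD addrACA -mulrBr (le_trans (nmD _ _))// mulrDl lerD ?kipP//.
by rewrite nmM -mulrA ler_wpM2l ?nm_ge0// kipP.
Qed.

Lemma kipC f g : kip f g = Num.conj (kip g f).
Proof.
apply: (@kip_uniq _ _ _ (nm f)) => [|t _]; first exact: nm_ge0.
apply: ler_eps => e e0.
pose D := nm (ev kpoint t) + nm g + nm (g - ev kpoint t) + 1.
have D0 : 0 < D by rewrite ltr_wpDl// !addr_ge0 ?nm_ge0.
(* For [s] close to [f], both sides are compared with the form [bil] of [t] and [s], whose symmetry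
   is known. *)
have [s hs] := @rkhs_dense f (e / D) (divr_gt0 e0 D0).
have h1 := pr_bound (f - ev kpoint s) t; rewrite prB pr_ev bilC in h1.
have h2 := pr_bound (g - ev kpoint t) s; rewrite prB pr_ev in h2.
have h3 := kipP g f s.
have h4 := nm_dist (Num.conj (bil k t s)) (pr f t) (Num.conj (kip g f)).
have h5 : nm (Num.conj (bil k t s) - Num.conj (kip g f)) = nm (bil k t s - kip g f).
  by rewrite -(nm_conj (bil k t s - _)) rmorphB.
have h6 := nm_dist (pr g s) (bil k t s) (kip g f).
rewrite (nmBC (pr g s)) in h2; rewrite h5 in h4.
have h7 : nm (ev kpoint s) <= nm f + nm (f - ev kpoint s).
  by have := nm_lerB (ev kpoint s) f; rewrite nmBC; lra.
have h8 := ler_wpM2l (nm_ge0 (g - ev kpoint t)) h7.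
rewrite ltr_pdivlMr// /D in hs.
have := nm_ge0 (f - ev kpoint s); lra.
Qed.

Lemma kip_norm f : kip f f = (nm f ^+ 2)%:C.
Proof.
(* Within distance 1 the combination has norm at most |f| + 1, and the two error terms add up to
   (|f| + 1) + (2|f| + 1) times the distance. *)
apply: (@kip_uniq _ _ _ (3 * nm f + 2)) => [|t t1].
  by rewrite addr_ge0// mulr_ge0// nm_ge0.
have h1 := pr_bound (f - ev kpoint t) t; rewrite prB pr_ev bilxx in h1.
have h2 := nm_dist (qf k t)%:C (pr f t) (nm f ^+ 2)%:C.
have h3 : nm ((qf k t)%:C - (nm f ^+ 2)%:C) =
    `|nm (ev kpoint t) - nm f| * (nm (ev kpoint t) + nm f).
  rewrite -rmorphB nm_real nm_ev -{1}(sqr_sqrtr (qf_ge0 k t)).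
  by rewrite subr_sqr normrM [X in _ * X]ger0_norm// addr_ge0 ?sqrtr_ge0 ?nm_ge0.
have h4 : `|nm (ev kpoint t) - nm f| <= nm (f - ev kpoint t).
  rewrite ler_norml; have := nm_lerB (ev kpoint t) f.
  by rewrite nmBC; have := nm_lerB f (ev kpoint t); lra.
have h5 : nm (ev kpoint t) <= nm f + 1.
  by have := ler_norm (nm (ev kpoint t) - nm f); lra.
have h6 : `|nm (ev kpoint t) - nm f| * (nm (ev kpoint t) + nm f) <=
    nm (f - ev kpoint t) * (nm (ev kpoint t) + nm f).
  by rewrite ler_wpM2r// addr_ge0 ?nm_ge0.
have h7 := ler_wpM2l (nm_ge0 (f - ev kpoint t)) h5.
lra.
Qed.

Let kip_Bl g : zmod_morphism (kip^~ g).
Proof.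
move=> f f'; rewrite addrC -scaleN1r kip_linear mulN1r addrC //.
Qed.

Let kip_Zl g : scalable_for *%R (kip^~ g).
Proof.
move=> a f; have := kip_linear a f 0 g; rewrite addr0 => ->.
have := kip_linear (-1) 0 0 g; rewrite scaler0 addr0 mulN1r addNr => ->.
by rewrite addr0.
Qed.

Let kip_Br f : zmod_morphism (kip f).
Proof.
move=> g g'; rewrite kipC [kip f g]kipC [kip f g']kipC.
by rewrite kip_Bl rmorphB.
Qed.

Let kip_Zr f : scalable_for (@Num.conj R[i] \; *%R) (kip f).
Proof. by move=> a g; rewrite kipC [kip f g]kipC kip_Zl cconjM. Qed.

HB.instance Definition _ := @isBilinear.Build R[i] (rkhs k) (rkhs k) R[i]
  *%R (@Num.conj R[i] \; *%R) kip kip_Bl kip_Br kip_Zl kip_Zr.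

Let kip_herm f g : kip f g = (-1) ^+ false * Num.conj (kip g f).
Proof. by rewrite expr0 mul1r kipC. Qed.

HB.instance Definition _ := @isHermitianSesquilinear.Build R[i] (rkhs k) false
  (@Num.conj R[i]) kip kip_herm.

Let kip_pos f : f != 0 -> 0 < kip f f.
Proof.
move=> f0; rewrite kip_norm ltcR exprn_gt0// lt_def nm_ge0 andbT.
by apply: contra_neq f0; exact: nm_eq0.
Qed.

HB.instance Definition _ := @isDotProduct.Build R[i] (rkhs k) kip kip_pos.

Let kip_norm' f : kip f f = `|f| ^+ 2.
Proof. by rewrite kip_norm nmE rmorphXn. Qed.

HB.instance Definition _ := @isHilbert.Build R (rkhs k) kip kip_norm'.

Lemma ip_kpoint x y : ip (kpoint x) (kpoint y) = k x y.
Proof.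
have := kipP (kpoint x) (kpoint y) [:: (1, y)].
rewrite ev1 subrr nm0 mulr0 /pr pair1 => h.
have /nm_eq0/eqP : nm (rval (kpoint x) y - kip (kpoint x) (kpoint y)) = 0.
  by apply/eqP; rewrite eq_le nm_ge0 andbT.
rewrite subr_eq0 => /eqP; rewrite /= /frep big_seq1/= mul1r => ->//.
Qed.
End KernelHilbert.

(** These two properties determine [phi] up to a unitary, and the later constructions rely on
    nothing else about the reproducing kernel space. *)
Lemma kolmogorov (R : realType) (X : Type) (k : kernel R X) :
  exists (L : hilbertType R) (phi : X -> L),
    (forall x y, ip (phi x) (phi y) = k x y) /\
    (forall v (e : R), 0 < e -> exists t, nm (v - ev phi t) < e).
Proof.
exists (rkhs k), (@kpoint R X k); split; [exact: ip_kpoint|exact: rkhs_dense].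
Qed.

(** * Tensor products *)

Section DenseFamily.
Variables (R : realType) (L : hilbertType R) (X : Type) (phi : X -> L).
Hypothesis phi_dense :
  forall v (e : R), 0 < e -> exists t, nm (v - ev phi t) < e.

Lemma ip_evr v t : ip v (ev phi t) = \sum_(p <- t) Num.conj p.1 * ip v (phi p.2).
Proof. by rewrite ip_sumr; apply: eq_bigr => p _; rewrite ipZr. Qed.

Lemma ip_evl v t : ip (ev phi t) v = \sum_(p <- t) p.1 * ip (phi p.2) v.
Proof. by rewrite ip_suml; apply: eq_bigr => p _; rewrite ipZl. Qed.

Lemma dense_ip0 v : (forall x, ip v (phi x) = 0) -> v = 0.
Proof.
move=> v0; apply: nm_le0.
apply: ler_eps => e e0; rewrite add0r; have [t ht] := phi_dense v e0.
apply: ip_nm_le; first exact: ltW.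
have -> : ip v v = ip v (v - ev phi t).
  rewrite ipBr [X in _ - X]ip_evr big1 ?subr0// => p _.
  by rewrite v0 mulr0.
rewrite (le_trans (cauchy_schwarz _ _))// mulrC ler_wpM2r ?nm_ge0// ltW //.
Qed.

Lemma dense_ip_eq v w : (forall x, ip v (phi x) = ip w (phi x)) -> v = w.
Proof.
move=> vw; apply/eqP; rewrite -subr_eq0; apply/eqP/dense_ip0 => x.
by rewrite ipBl vw subrr.
Qed.

Lemma dense_ext (W : normedModType R[i]) (F G : L -> W) (M N : R) :
  0 <= M -> 0 <= N -> linear F -> linear G ->
  (forall v, nm (F v) <= M * nm v) -> (forall v, nm (G v) <= N * nm v) ->
  (forall x, F (phi x) = G (phi x)) -> forall v, F v = G v.
Proof.
move=> M0 N0 Fl Gl FM GN FG v; apply/eqP; rewrite -subr_eq0; apply/eqP.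
apply: (@dense_eq0 R L (@nm R L) X phi phi_dense W (@nm R W)
  (fun v => F v - G v) (M + N)).
- exact: nm_le0.
- exact: addr_ge0.
- by move=> k u w; rewrite Fl Gl scalerBr opprD addrACA.
- by move=> w; rewrite (le_trans (nmB _ _))// mulrDl lerD.
- by move=> x; rewrite FG subrr.
Qed.

(** The constant [N] only provides continuity; the sharp constant [M] is known on the dense set of
    combinations. *)
Lemma dense_bound (W : normedModType R[i]) (F : {linear L -> W}) (M N : R) :
  0 <= M -> 0 <= N -> (forall v, nm (F v) <= N * nm v) ->
  (forall t, nm (F (ev phi t)) <= M * nm (ev phi t)) ->
  forall v, nm (F v) <= M * nm v.
Proof.
move=> M0 N0 FN FM v; apply: ler_eps => e e0.
have D0 : 0 < M + N + 1 by rewrite ltr_wpDl// addr_ge0.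
have [t ht] := phi_dense v (divr_gt0 e0 D0).
have h1 := nm_dist (F (ev phi t)) (F v) 0; rewrite !subr0 -linearB in h1.
have h2 := nm_dist v (ev phi t) 0; rewrite !subr0 (nmBC _ v) in h2.
rewrite ltr_pdivlMr// in ht; have h3 := FM t; have h4 := FN (v - ev phi t).
have h5 := ler_wpM2l M0 h2; have := nm_ge0 (v - ev phi t); lra.
Qed.

Lemma rep_ext (E E' : cstarType R) (pi pi' : starRep E L) (rho rho' : starRep E' L) a b :
  (forall x, pi a (rho b (phi x)) = rho' b (pi' a (phi x))) ->
  forall v, pi a (rho b v) = rho' b (pi' a v).
Proof.
move=> e v; apply: (@dense_ext L (fun v => pi a (rho b v)) (fun v => rho' b (pi' a v))
  (cnorm a * cnorm b) (cnorm b * cnorm a)) => //.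
- by rewrite mulr_ge0 ?cnorm_ge0.
- by rewrite mulr_ge0 ?cnorm_ge0.
- by move=> k u w; rewrite !linearP.
- by move=> k u w; rewrite !linearP.
- move=> w; rewrite (le_trans (rep_contractive _ _ _))// -mulrA.
  by rewrite ler_wpM2l ?cnorm_ge0// rep_contractive.
- move=> w; rewrite (le_trans (rep_contractive _ _ _))// -mulrA.
  by rewrite ler_wpM2l ?cnorm_ge0// rep_contractive.
Qed.

Lemma rep1_ext (E : cstarType R) (pi : starRep E L) :
  (forall x, pi 1 (phi x) = phi x) -> forall v, pi 1 v = v.
Proof.
move=> e v; apply: (@dense_ext L (pi 1) id (cnorm (1 : E)) 1) => //.
- exact: cnorm_ge0.
- by move=> k u w; rewrite linearP.
- exact: rep_contractive.
- by move=> w; rewrite mul1r.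
Qed.
End DenseFamily.

Definition fconj (R : realType) (X : Type) (t : seq (R[i] * X)) :=
  [seq (Num.conj p.1, p.2) | p <- t].

(** [chi] behaves like [phi] followed by an antiunitary map, so conjugated coefficients give a
    vector of the same norm. *)
Lemma ev_fconj_norm (R : realType) (H L : hilbertType R) (X : Type)
  (phi : X -> H) (chi : X -> L) t :
  (forall x y, ip (chi x) (chi y) = ip (phi y) (phi x)) ->
  nm (ev chi (fconj t)) = nm (ev phi t).
Proof.
move=> e; have : nm (ev chi (fconj t)) ^+ 2 = nm (ev phi t) ^+ 2.
  rewrite -!Re_ipxx; congr complex.Re.
  rewrite ip_evl big_map; under eq_bigr do rewrite ip_evr big_map.
  rewrite ip_evr; under [RHS]eq_bigr do rewrite ip_evl.
  apply: eq_bigr => p _; congr (_ * _); apply: eq_bigr => q _.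
  by rewrite cconjK e.
by move=> /eqP; rewrite eqrXn2 ?nm_ge0// => /eqP.
Qed.

Section TensorKernels.
Variable R : realType.

Lemma map_kernel_subproof (X : Type) (H : hilbertType R) (f : X -> H) t :
  pairing (frep (fun x y => ip (f x) (f y)) t) t = ip (ev f t) (ev f t).
Proof.
rewrite ip_evr; apply: eq_bigr => p _; congr (_ * _).
by rewrite ip_evl.
Qed.

(** The Hilbert space of this Gram kernel is the closed span of the range of [f]; it turns the
    B-central vectors into a Hilbert space of their own. *)
Definition map_kernel (X : Type) (H : hilbertType R) (f : X -> H) : kernel R X.
Proof.
apply: (@Kernel R X (fun x y => ip (f x) (f y))) => [x y|t]; first exact: ipC.
by rewrite map_kernel_subproof Re_ipxx sqr_ge0.
Defined.

Definition conj_kernel (H : hilbertType R) : kernel R H.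
Proof.
apply: (@Kernel R H (fun x y => ip y x)) => [x y|t]; first exact: ipC.
have -> : pairing (frep (fun x y : H => ip y x) t) t =
    ip (ev id (fconj t)) (ev id (fconj t)).
  rewrite ip_evl big_map; apply: eq_bigr => p _; congr (_ * _).
  by rewrite ip_evr big_map; apply: eq_bigr => q _; rewrite cconjK.
by rewrite Re_ipxx sqr_ge0.
Defined.

Lemma conj_space (H : hilbertType R) : exists (L : hilbertType R) (c : H -> L),
  (forall x y, ip (c x) (c y) = ip y x) /\
  (forall v (e : R), 0 < e -> exists t, nm (v - ev c t) < e).
Proof. exact: (kolmogorov (conj_kernel H)). Qed.

(* Subtract from all the second components their projection on the direction of
   the first one: this splits off a square and kills the first term. *)
Lemma schur_pos (H K : hilbertType R) (s : seq (H * K)) :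
  0 <= complex.Re (\sum_(p <- s) \sum_(q <- s) ip p.1 q.1 * ip p.2 q.2).
Proof.
have [n] := ubnP (size s); elim: n s => // n IH [|[x0 y0] s]; first by rewrite big_nil.
rewrite ltnS => /= sn.
(* If [y0 = 0] the inverse is 0 by convention, so [e = 0] and [pj] is the identity, which still
   kills [y0]. *)
pose e := (nm y0)^-1%:C *: y0.
pose pj (y : K) : K := y - ip y e *: e.
have ey0 : pj y0 = 0.
  rewrite /pj /e ipZr ipxx conj_real scalerA -!rmorphM.
  have [y00|y00] := eqVneq (nm y0) 0.
    by rewrite [y0](nm_eq0 y00) !scaler0 subr0.
  have -> : (nm y0)^-1 * nm y0 ^+ 2 * (nm y0)^-1 = 1 by field.
  by rewrite rmorph1 scale1r subrr.
have ee y : ip (pj y) e = 0.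
  rewrite ipBl ipZl ipxx /e; have [y00|y00] := eqVneq (nm y0) 0.
    by rewrite [y0](nm_eq0 y00) scaler0 ip0r mul0r subrr.
  by rewrite nmZ nm_real normfV ger0_norm ?nm_ge0// mulVf// expr1n mulr1 subrr.
have split y z : ip y z = ip y e * Num.conj (ip z e) + ip (pj y) (pj z).
  have -> : ip (pj y) (pj z) = ip (pj y) z.
    by rewrite ipBr ipZr ee mulr0 subr0.
  by rewrite ipBl ipZl -ipC addrC subrK.
set t := (x0, y0) :: s.
have -> : \sum_(p <- t) \sum_(q <- t) ip p.1 q.1 * ip p.2 q.2 =
    ip (\sum_(p <- t) ip p.2 e *: p.1) (\sum_(p <- t) ip p.2 e *: p.1) +
    \sum_(p <- t) \sum_(q <- t) ip p.1 q.1 * ip (pj p.2) (pj q.2).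
  rewrite ip_suml -big_split; apply: eq_bigr => p _ /=.
  rewrite ip_sumr -big_split; apply: eq_bigr => q _ /=.
  by rewrite split mulrDr ipZl ipZr; congr (_ + _); ring.
have -> : \sum_(p <- t) \sum_(q <- t) ip p.1 q.1 * ip (pj p.2) (pj q.2) =
   \sum_(p <- [seq (p.1, pj p.2) | p <- s]) 
   \sum_(q <- [seq (p.1, pj p.2) | p <- s]) ip p.1 q.1 * ip p.2 q.2.
  rewrite big_cons big1 ?add0r; last by move=> q _ /=; rewrite ey0 ip0l mulr0.
  rewrite big_map; apply: eq_bigr => p _; rewrite big_cons big_map /=.
  by rewrite ey0 ip0r mulr0 add0r.
rewrite ReD addr_ge0//; first by rewrite Re_ipxx sqr_ge0.
by apply: IH; rewrite size_map.
Qed.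

Definition tensor_kernel (H K : hilbertType R) : kernel R (H * K).
Proof.
apply: (@Kernel R (H * K) (fun p q => ip p.1 q.1 * ip p.2 q.2)) => [p q|t].
  by rewrite cconjM -!ipC.
have -> : pairing (frep (fun p q : H * K => ip p.1 q.1 * ip p.2 q.2) t) t =
    \sum_(p <- [seq (r.1 *: r.2.1, r.2.2) | r <- t])
    \sum_(q <- [seq (r.1 *: r.2.1, r.2.2) | r <- t]) ip p.1 q.1 * ip p.2 q.2.
  rewrite /pairing /frep exchange_big big_map; apply: eq_bigr => q _.
  rewrite big_map mulr_sumr; apply: eq_bigr => p _ /=.
  by rewrite ipZl ipZr; ring.
exact: schur_pos.
Defined.

(** [phi] is bilinear because the two sides of each identity have equal inner products with the
    dense family. *)
Lemma hilbert_tensor_exists (H K : hilbertType R) :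
  exists (L : hilbertType R) (tau : {bilinear H -> K -> L}), hilbert_tensor tau.
Proof.
have [L [phi [ipphi phid]]] := kolmogorov (tensor_kernel H K).
pose tau x y := phi (x, y).
have Pl y : linear (tau^~ y).
  move=> k x x'; apply: (dense_ip_eq phid) => -[u w].
  by rewrite ipDl ipZl !ipphi/= ipDl ipZl mulrDl mulrA.
have Pr x : linear (tau x).
  move=> k y y'; apply: (dense_ip_eq phid) => -[u w].
  by rewrite ipDl ipZl !ipphi/= ipDl ipZl mulrDr mulrCA.
pose tau' : {bilinear H -> K -> L} :=
  HB.pack tau (@bilinear_isBilinear.Build R[i] H K L *:%R *:%R tau (Pl, Pr)).
exists L, tau'; split; first by move=> x x' y y'; exact: (ipphi (x, y) (x', y')).
apply/denseP => v e e0; have [t ht] := phid v e e0; exists (ev phi t) => //.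
apply/(@linear_spanP R L (H * K) phi); last by exists t.
by move=> w; split=> [[x [y ->]]|[[x y] ->]]; [exists (x, y)|exists x, y].
Qed.
End TensorKernels.

Section HilbertTensor.
Variables (R : realType) (H K L : hilbertType R) (tau : {bilinear H -> K -> L}).
Hypothesis htau : hilbert_tensor tau.

Definition tens (p : H * K) : L := tau p.1 p.2.

Lemma ip_tens p q : ip (tens p) (tens q) = ip p.1 q.1 * ip p.2 q.2.
Proof. by case: htau => ht _; exact: ht. Qed.

Lemma tens_dense v (e : R) : 0 < e -> exists t, nm (v - ev tens t) < e.
Proof.
case: htau => _ /denseP hd e0; have [w /(@linear_spanP R L _ tens)[|t ->]] := hd v e e0.
  by move=> u; split=> [[x [y ->]]|[[x y] ->]]; [exists (x, y)|exists x, y].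
by exists t.
Qed.

Lemma nm_tens p : nm (tens p) = nm p.1 * nm p.2.
Proof.
have : nm (tens p) ^+ 2 = (nm p.1 * nm p.2) ^+ 2.
  by rewrite -Re_ipxx ip_tens !ipxx -rmorphM exprMn.
by move=> /eqP; rewrite eqrXn2 ?mulr_ge0 ?nm_ge0// => /eqP.
Qed.

Lemma tens_linearl (k : R[i]) x x' y :
  tens (k *: x + x', y) = k *: tens (x, y) + tens (x', y).
Proof. by rewrite /tens/= linearDl/= linearZl_LR. Qed.

Lemma tens_linearr (k : R[i]) x y y' :
  tens (x, k *: y + y') = k *: tens (x, y) + tens (x, y').
Proof. by rewrite /tens/= linearDr/= linearZr_LR. Qed.

Lemma tensBl x x' y : tens (x - x', y) = tens (x, y) - tens (x', y).
Proof. by rewrite addrC -scaleN1r tens_linearl scaleN1r addrC. Qed.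

Lemma tensBr x y y' : tens (x, y - y') = tens (x, y) - tens (x, y').
Proof. by rewrite addrC -scaleN1r tens_linearr scaleN1r addrC. Qed.

Lemma amplify_left (E : cstarType R) (pi : starRep E H) :
  exists P : starRep E L, forall a x y, P a (tens (x, y)) = tens (pi a x, y).
Proof.
have [|k a b p|a b p|P PE] :=
    @rep_on_family R E L _ tens (fun a p => (pi a p.1, p.2)) tens_dense.
- by move=> a p q; rewrite !ip_tens/= rep_ip.
- by rewrite rep_linear tens_linearl.
- by rewrite /= repM.
by exists P => a x y; rewrite PE.
Qed.

Lemma amplify_right (E : cstarType R) (rho : starRep E K) :
  exists P : starRep E L, forall a x y, P a (tens (x, y)) = tens (x, rho a y).
Proof.
have [|k a b p|a b p|P PE] :=
    @rep_on_family R E L _ tens (fun a p => (p.1, rho a p.2)) tens_dense.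
- by move=> a p q; rewrite !ip_tens/= rep_ip.
- by rewrite rep_linear tens_linearr.
- by rewrite /= repM.
by exists P => a x y; rewrite PE.
Qed.

Section MinNorm.
Variables (B D : cstarType R) (pi : starRep B H) (rho : starRep D K).
Variables (P : starRep B L) (Q : starRep D L).
Hypothesis PE : forall a x y, P a (tens (x, y)) = tens (pi a x, y).
Hypothesis QE : forall a x y, Q a (tens (x, y)) = tens (x, rho a y).

Lemma min_norm_bound (t : seq (B * D)) (M : R) : min_norm t = M%:E ->
  forall v, nm (\sum_(p <- t) P p.1 (Q p.2 v)) <= M * nm v.
Proof.
move=> tM; pose T v := \sum_(p <- t) P p.1 (Q p.2 v).
have Tl : linear T.
  move=> k x y; rewrite /T scaler_sumr -big_split.
  by apply: eq_bigr => p _; rewrite !linearP.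
pose T' := mkLinear Tl.
(* This crude bound only provides the continuity required of the operators in [min_norm]. *)
have Tb v : nm (T' v) <= (\sum_(p <- t) cnorm p.1 * cnorm p.2) * nm v.
  rewrite /T' /= /T (le_trans (nm_sum _ _))// mulr_suml; apply: ler_sum => p _.
  rewrite (le_trans (rep_contractive _ _ _))// -mulrA.
  by rewrite ler_wpM2l ?cnorm_ge0// rep_contractive.
apply: (@opnorm_le R L T').
rewrite -tM; apply: ereal_sup_ubound; exists H, K, L, tau, pi, rho, T'; split=> //.
  exact: bounded_continuous Tb.
by move=> x y; apply: eq_bigr => p _; rewrite -/(tens (x, y)) QE PE.
Qed.
End MinNorm.

Section Slices.
Variable y : K.

(** If [w] is the image of the combination t, then <w, w> is the inner product of t with the tensor
    of [w] and [y], and Cauchy-Schwarz gives the bound. *)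
Lemma slice_exists : exists S : {linear L -> H},
  (forall p, S (tens p) = ip p.2 y *: p.1) /\ (forall v, nm (S v) <= nm y * nm v).
Proof.
have [|t|S S1 S2] := @extension R L (@nm R L) (@nmD R L) (@nmZ R L) _ tens
  tens_dense H (fun p => ip p.2 y *: p.1) (nm y).
- exact: nm_ge0.
- apply: ip_nm_le; first by rewrite mulr_ge0 ?nm_ge0.
  set w := ev _ t; have -> : ip w w = ip (ev tens t) (tens (w, y)).
    rewrite {1}/w !ip_evl; apply: eq_bigr => p _.
    by rewrite ip_tens ipZl/= [ip p.2.2 y * _]mulrC.
  by apply: le_trans (cauchy_schwarz _ _) _; rewrite nm_tens/=; lra.
by exists S.
Qed.

Definition slice : {linear L -> H} := sval (cid slice_exists).

Lemma sliceE p : slice (tens p) = ip p.2 y *: p.1.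
Proof. exact: (svalP (cid slice_exists)).1. Qed.

Lemma slice_bound v : nm (slice v) <= nm y * nm v.
Proof. exact: (svalP (cid slice_exists)).2. Qed.

Lemma ip_slice v x : ip (slice v) x = ip v (tens (x, y)).
Proof.
apply/eqP; rewrite -subr_eq0; apply/eqP.
apply: (@dense_eq0 R L (@nm R L) _ tens tens_dense R[i] (@nm R R[i])
  (fun v => ip (slice v) x - ip v (tens (x, y))) (nm y * nm x + nm x * nm y)).
- exact: nm_le0.
- by rewrite addr_ge0 ?mulr_ge0 ?nm_ge0.
- by move=> l u w; rewrite linearP/= !(ipDl, ipZl) [l *: _]mulrBr opprD addrACA.
- move=> w; rewrite (le_trans (nmB _ _))// mulrDl lerD//.
    rewrite (le_trans (cauchy_schwarz _ _))// mulrAC ler_wpM2r ?nm_ge0//.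
    exact: slice_bound.
  by rewrite (le_trans (cauchy_schwarz _ _))// nm_tens mulrC.
- by move=> p; rewrite sliceE ip_tens ipZl mulrC subrr.
Qed.

Lemma slice_rep (E : cstarType R) (pi : starRep E H) (P : starRep E L) a v :
  (forall a x y, P a (tens (x, y)) = tens (pi a x, y)) ->
  slice (P a v) = pi a (slice v).
Proof.
move=> PE; apply: (@dense_ext R L _ tens tens_dense H (fun v => slice (P a v))
  (fun v => pi a (slice v)) (nm y * cnorm a) (cnorm a * nm y)).
- by rewrite mulr_ge0 ?cnorm_ge0 ?nm_ge0.
- by rewrite mulr_ge0 ?cnorm_ge0 ?nm_ge0.
- by move=> k u w; rewrite !linearP.
- by move=> k u w; rewrite !linearP.
- move=> w; rewrite (le_trans (slice_bound _))// -mulrA.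
  by rewrite ler_wpM2l ?nm_ge0// rep_contractive.
- move=> w; rewrite (le_trans (rep_contractive _ _ _))// -mulrA.
  by rewrite ler_wpM2l ?cnorm_ge0// slice_bound.
- by move=> [x z]; rewrite PE !sliceE linearZ.
Qed.
End Slices.

Lemma slice_eq0 v : (forall y, slice y v = 0) -> v = 0.
Proof.
move=> v0; apply: (dense_ip0 tens_dense) => -[x y].
by rewrite -ip_slice v0 ip0l.
Qed.
End HilbertTensor.

(** * Opposite algebras, conjugate spaces and the minimal norm *)

Section OppositeCompletion.
Variables (R : realType) (B A : cstarType R) (j : {lrmorphism B -> A}).

Definition op_fun : (B^c)%type -> (A^c)%type := fun b => j b.

Let op_zmod : zmod_morphism op_fun. Proof. by move=> x y; exact: (raddfB j x y). Qed.
Let op_scal : scalable op_fun. Proof. by move=> k x; exact: (linearZ_LR j k x). Qed.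
Let op_mon : monoid_morphism op_fun.
Proof. by split; [exact: (rmorph1 j)|move=> x y; exact: (rmorphM j y x)]. Qed.

HB.instance Definition _ := GRing.isZmodMorphism.Build _ _ op_fun op_zmod.
HB.instance Definition _ := GRing.isScalable.Build _ _ _ _ op_fun op_scal.
HB.instance Definition _ := GRing.isMonoidMorphism.Build _ _ op_fun op_mon.

Definition op_morphism : {lrmorphism (B^c)%type -> (A^c)%type} := op_fun.
End OppositeCompletion.

(** Elementary tensors are the same in [A] and its opposite because the two factors commute. [N]
    remains the norm function of [B] and [D]; [min_tensor_bound_op] bounds right actions by it. *)
Lemma op_completion (R : realType) (B D A : cstarType R) (N : seq (B * D) -> \bar R)
  (iB : {lrmorphism B -> A}) (iD : {lrmorphism D -> A}) :
  tensor_completion N iB iD ->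
  @tensor_completion R (B^c)%type (D^c)%type (A^c)%type N (op_morphism iB) (op_morphism iD).
Proof.
case=> [[h1 h2] h3 h4 h5].
have e (t : seq (B * D)) :
    \sum_(p <- t) (op_morphism iB p.1 * op_morphism iD p.2 : (A^c)%type) =
    \sum_(p <- t) iB p.1 * iD p.2 :> A.
  by apply: eq_bigr => p _; rewrite h3.
split.
- by split=> [b|d]; [exact: h1|exact: h2].
- by move=> b d; exact: (esym (h3 b d)).
- by move=> t; have := h4 t; rewrite -e.
- move=> a e' e0; have [t ht] := h5 a e' e0; exists t; move: ht; rewrite -e //.
Qed.

Lemma rep_of_pair (R : realType) (B D A : cstarType R) (N : seq (B * D) -> \bar R)
  (iB : {lrmorphism B -> A}) (iD : {lrmorphism D -> A}) (L : hilbertType R)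
  (P : starRep B L) (Q : starRep D L) :
  tensor_completion N iB iD ->
  (forall b d x, P b (Q d x) = Q d (P b x)) ->
  (forall (t : seq (R[i] * (B * D))) x,
    nm (ev (fun p => P p.1 (Q p.2 x)) t) <= cnorm (ev (elem iB iD) t) * nm x) ->
  exists pi : starRep A L, forall b d x, pi (iB b * iD d) x = P b (Q d x).
Proof.
move=> hA PQ bound.
apply: (@rep_on_completion R B D A N iB iD hA L (fun p x => P p.1 (Q p.2 x))) => //=.
- by move=> p k x y; rewrite !linearP.
- by move=> b d x y; rewrite !rep_ip PQ.
- by move=> b d b' d' x; rewrite !repM -!PQ.
Qed.

(** Passing to the conjugate space makes the action antilinear in the algebra, and the opposite
    product reverses factors; inserting the star corrects both. *)
Lemma conj_rep (R : realType) (E : cstarType R) (H Hc : hilbertType R) (c : H -> Hc)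
  (pi : starRep (E^c)%type H) :
  (forall x y, ip (c x) (c y) = ip y x) ->
  (forall v (e : R), 0 < e -> exists t, nm (v - ev c t) < e) ->
  exists pi' : starRep E Hc, forall a x, pi' a (c x) = c (pi (star a) x).
Proof.
move=> ipc dc; apply: rep_on_family => //.
- by move=> a x y; rewrite !ipc starK; exact: esym (rep_ip pi a y x).
- move=> k a b x; apply: (dense_ip_eq dc) => y.
  rewrite ipDl ipZl !ipc starD starZ rep_linear ipDr ipZr cconjK //.
- by move=> a b x; rewrite starM -repM.
Qed.

Lemma ev_sum_rep (R : realType) (B D : cstarType R) (L : hilbertType R)
  (P : starRep B L) (Q : starRep D L) (t : seq (R[i] * (B * D))) v :
  ev (fun p => P p.1 (Q p.2 v)) t = \sum_(p <- unscale t) P p.1 (Q p.2 v).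
Proof. by rewrite big_map; apply: eq_bigr => p _ /=; rewrite repZ. Qed.

(** With [f] an action, this is a formal combination of algebra elements applied to a formal
    combination of vectors. *)
Definition fprod (R : realType) (X Y Z : Type) (f : X -> Y -> Z)
  (t : seq (R[i] * X)) (s : seq (R[i] * Y)) : seq (R[i] * Z) :=
  [seq (p.1 * q.1, f p.2 q.2) | p <- t, q <- s].

Lemma ev_fprod (R : realType) (V : lmodType R[i]) (X Y Z : Type) (f : X -> Y -> Z)
  (phi : Z -> V) (t : seq (R[i] * X)) (s : seq (R[i] * Y)) :
  ev phi (fprod f t s) = ev (fun x => ev (fun y => phi (f x y)) s) t.
Proof.
rewrite /ev /fprod big_allpairs_dep; apply: eq_bigr => p _.
by rewrite scaler_sumr; apply: eq_bigr => q _; rewrite scalerA.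
Qed.

Lemma fconj_fprod (R : realType) (X Y Z : Type) (f : X -> Y -> Z)
  (t : seq (R[i] * X)) (s : seq (R[i] * Y)) :
  fconj (fprod f t s) = fprod f (fconj t) (fconj s).
Proof.
rewrite /fconj /fprod map_allpairs allpairs_mapl allpairs_mapr.
by apply: eq_allpairs => p q /=; rewrite cconjM.
Qed.

Lemma ev_elem_star (R : realType) (B D A : cstarType R) (N : seq (B * D) -> \bar R)
  (iB : {lrmorphism B -> A}) (iD : {lrmorphism D -> A}) t :
  tensor_completion N iB iD ->
  ev (elem iB iD) (fmap (fun p => (star p.1, star p.2)) (fconj t)) =
  star (ev (elem iB iD) t).
Proof.
move=> hA; elim: t => [|[k [b d]] t IH]; first by rewrite !ev_nil star0.
by rewrite /= !ev_cons IH starD starZ (elem_star hA).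
Qed.

Section MinTensor.
Variables (R : realType) (B D A : cstarType R).
Variables (jB : {lrmorphism B -> A}) (jD : {lrmorphism D -> A}).
Hypothesis hA : min_tensor jB jD.
Variables (H K L : hilbertType R) (tau : {bilinear H -> K -> L}).
Hypothesis htau : hilbert_tensor tau.

Lemma min_tensor_bound (pi : starRep B H) (rho : starRep D K)
  (P : starRep B L) (Q : starRep D L)
  (PE : forall a x y, P a (tens tau (x, y)) = tens tau (pi a x, y))
  (QE : forall a x y, Q a (tens tau (x, y)) = tens tau (x, rho a y))
  (t : seq (R[i] * (B * D))) v :
  nm (ev (fun p => P p.1 (Q p.2 v)) t) <= cnorm (ev (elem jB jD) t) * nm v.
Proof.
rewrite ev_sum_rep; apply: (min_norm_bound htau PE QE).
exact: (tensor_norm hA).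
Qed.
End MinTensor.

(* A right action on H is a left action on the conjugate space of H, to which
   the minimal norm applies. *)
Lemma min_tensor_bound_op (R : realType) (B D A : cstarType R)
  (jB : {lrmorphism B -> A}) (jD : {lrmorphism D -> A})
  (H K L : hilbertType R) (tau : {bilinear H -> K -> L})
  (pi : starRep (B^c)%type H) (rho : starRep (D^c)%type K)
  (P : starRep (B^c)%type L) (Q : starRep (D^c)%type L) :
  min_tensor jB jD -> hilbert_tensor tau ->
  (forall a x y, P a (tens tau (x, y)) = tens tau (pi a x, y)) ->
  (forall a x y, Q a (tens tau (x, y)) = tens tau (x, rho a y)) ->
  forall (t : seq (R[i] * (B * D))) v,
  nm (ev (fun p => P p.1 (Q p.2 v)) t) <= cnorm (ev (elem jB jD) t) * nm v.
Proof.
move=> hA htau PE QE t.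
have [Hc [cH [ipH dH]]] := conj_space H; have [Kc [cK [ipK dK]]] := conj_space K.
have [pi' pi'E] := conj_rep pi ipH dH; have [rho' rho'E] := conj_rep rho ipK dK.
have [Lc [tau' htau']] := hilbert_tensor_exists Hc Kc.
have [P' P'E] := amplify_left htau' pi'; have [Q' Q'E] := amplify_right htau' rho'.
pose chi (p : H * K) := tens tau' (cH p.1, cK p.2).
have chiE p q : ip (chi p) (chi q) = ip (tens tau q) (tens tau p).
  by rewrite !ip_tens //= ipH ipK.
pose F v := ev (fun p : B * D => P p.1 (Q p.2 v)) t.
have Fl : linear F.
  move=> k x y; rewrite /F /ev scaler_sumr -big_split; apply: eq_bigr => p _ /=.
  by rewrite !linearP.
apply: (@dense_bound R L _ (tens tau) (tens_dense htau) L (mkLinear Fl) _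
  (\sum_(p <- t) nm p.1 * (cnorm p.2.1 * cnorm p.2.2))).
- exact: cnorm_ge0.
- by apply: sumr_ge0 => p _; rewrite !mulr_ge0 ?nm_ge0 ?cnorm_ge0.
- move=> v; rewrite /= /F /ev (le_trans (nm_sum _ _))// mulr_suml.
  apply: ler_sum => p _; rewrite nmZ -!mulrA ler_wpM2l ?nm_ge0//.
  rewrite (le_trans (rep_contractive _ _ _))//.
  by rewrite ler_wpM2l ?cnorm_ge0//; exact: rep_contractive.
move=> s /=.
pose act (p : B * D) (q : H * K) := (pi p.1 q.1, rho p.2 q.2).
pose st (p : B * D) := (star p.1, star p.2).
have -> : F (ev (tens tau) s) = ev (tens tau) (fprod act t s).
  rewrite ev_fprod; apply: eq_bigr => p _; congr (_ *: _).
  have Gl : linear (fun v => P p.2.1 (Q p.2.2 v)) by move=> k x y; rewrite !linearP.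
  rewrite (ev_linear _ _ Gl); apply: eq_ev => -[x y] /=.
  by rewrite QE PE.
(* Both norms are computed in the tensor product of the conjugate spaces, where [t] acts from the
   left as its adjoint, an element of the same norm. *)
rewrite -(ev_fconj_norm (fprod act t s) chiE) -(ev_fconj_norm s chiE) fconj_fprod.
have -> : ev chi (fprod act (fconj t) (fconj s)) =
    ev (fun p => P' p.1 (Q' p.2 (ev chi (fconj s)))) (fmap st (fconj t)).
  rewrite ev_fprod ev_fmap; apply: eq_ev => p /=.
  have Gl : linear (fun v => P' (star p.1) (Q' (star p.2) v)).
    by move=> k x y; rewrite !linearP.
  rewrite (ev_linear _ _ Gl); apply: eq_ev => -[x y] /=.
  by rewrite Q'E P'E pi'E rho'E !starK.
have := min_tensor_bound hA htau' P'E Q'E (fmap st (fconj t)) (ev chi (fconj s)).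
by rewrite (ev_elem_star _ hA) cnorm_starE.
Qed.

Section TensorBimodule.
Variables (R : realType) (B D A : cstarType R).
Variables (jB : {lrmorphism B -> A}) (jD : {lrmorphism D -> A}).
Hypothesis hA : min_tensor jB jD.
Variables (H : hilbertBimod B) (K : hilbertBimod D).

Lemma tensor_bimod : exists (L : hilbertBimod A) (tau : {bilinear H -> K -> L}),
  [/\ hilbert_tensor tau,
    forall b d x y, lact L (jB b * jD d) (tens tau (x, y)) =
                    tens tau (lact H b x, lact K d y) &
    forall b d x y, ract L (jB b * jD d) (tens tau (x, y)) =
                    tens tau (ract H b x, ract K d y)].
Proof.
have [L [tau htau]] := hilbert_tensor_exists H K.
have [lP lPE] := amplify_left htau (lact H).
have [lQ lQE] := amplify_right htau (lact K).
have [rP rPE] := amplify_left htau (ract H).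
have [rQ rQE] := amplify_right htau (ract K).
have dL := tens_dense htau.
have lPQ b d x : lP b (lQ d x) = lQ d (lP b x).
  by apply: (rep_ext dL) => -[u v]; rewrite lQE !lPE lQE.
have rPQ b d x : rP b (rQ d x) = rQ d (rP b x).
  by apply: (rep_ext dL) => -[u v]; rewrite rQE !rPE rQE.
have lrPP b d x : lP b (rP d x) = rP d (lP b x).
  by apply: (rep_ext dL) => -[u v]; rewrite rPE !lPE rPE lactrC.
have lrPQ b d x : lP b (rQ d x) = rQ d (lP b x).
  by apply: (rep_ext dL) => -[u v]; rewrite rQE !lPE rQE.
have lrQP b d x : lQ b (rP d x) = rP d (lQ b x).
  by apply: (rep_ext dL) => -[u v]; rewrite rPE !lQE rPE.
have lrQQ b d x : lQ b (rQ d x) = rQ d (lQ b x).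
  by apply: (rep_ext dL) => -[u v]; rewrite rQE !lQE rQE lactrC.
have [l lE] := rep_of_pair hA lPQ (min_tensor_bound hA htau lPE lQE).
(* The product of [A^c] is reversed: [jB b] times [jD d] there is this product in [A]. *)
have [r rE] : exists r : starRep (A^c)%type L,
    forall b d x, r (jD d * jB b : A) x = rP b (rQ d x).
  apply: (rep_of_pair (op_completion hA) rPQ) => t x.
  have := min_tensor_bound_op hA htau rPE rQE t x.
  congr (_ <= _ * _); congr (cnorm _); apply: eq_bigr => p _; congr (_ *: _).
  exact: (tensor_comm hA).
have {}rE b d x : r (jB b * jD d : A) x = rP b (rQ d x).
  by rewrite (tensor_comm hA) rE.
have elem1E : 1 = jB 1 * jD 1 by rewrite !rmorph1 mulr1.
have lP1 : forall x, lP 1 x = x by apply: (rep1_ext dL) => -[u v]; rewrite lPE lact1.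
have lQ1 : forall x, lQ 1 x = x by apply: (rep1_ext dL) => -[u v]; rewrite lQE lact1.
have rP1 : forall x, rP 1 x = x by apply: (rep1_ext dL) => -[u v]; rewrite rPE ract1.
have rQ1 : forall x, rQ 1 x = x by apply: (rep1_ext dL) => -[u v]; rewrite rQE ract1.
have l1 x : l 1 x = x by rewrite elem1E lE lQ1 lP1.
have r1 x : r 1 x = x.
  have := rE 1 1 x; rewrite -elem1E => e1.
  by apply: etrans e1 _; rewrite [rQ _ _]rQ1 [LHS]rP1.
have dA := @tensor_dense _ _ _ _ _ _ _ hA.
(* The left and right actions of [A] are shown to commute by density in one variable at a time,
   first in the right one. *)
have lrC0 p a x : l (elem jB jD p) (r a x) = r a (l (elem jB jD p) x).
  apply/eqP; rewrite -subr_eq0; apply/eqP.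
  pose F (a : A) := l (elem jB jD p) (r a x) - r a (l (elem jB jD p) x).
  apply: (@dense_eq0 R A (@cnorm R A) _ _ dA L (@nm R L) F
    (cnorm (elem jB jD p) * nm x + nm (l (elem jB jD p) x))).
  - exact: nm_le0.
  - by rewrite addr_ge0 ?mulr_ge0 ?cnorm_ge0 ?nm_ge0.
  - move=> k u v; rewrite /F.
    rewrite [r _ x](rep_linear r k u v) [r _ (l _ x)](rep_linear r k u v).
    by rewrite linearP scalerBr opprD addrACA.
  - move=> v; rewrite (le_trans (nmB _ _))// mulrDl lerD//.
      rewrite (le_trans (rep_contractive _ _ _))// -mulrA ler_wpM2l ?cnorm_ge0//.
      by rewrite mulrC; exact: (rep_contractive r v).
    by rewrite mulrC; exact: (rep_contractive r v).
  - case: p @F => b d F [b' d']; rewrite /F /elem/= !rE !lE.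
    by rewrite lrQP lrPP lrQQ lrPQ subrr.
have lrC a a' x : l a (r a' x) = r a' (l a x).
  apply/eqP; rewrite -subr_eq0; apply/eqP.
  apply: (@dense_eq0 R A (@cnorm R A) _ _ dA L (@nm R L)
    (fun a => l a (r a' x) - r a' (l a x)) (nm (r a' x) + cnorm (a' : A) * nm x)).
  - exact: nm_le0.
  - by rewrite addr_ge0 ?mulr_ge0 ?cnorm_ge0 ?nm_ge0.
  - by move=> k u v; rewrite !rep_linear linearP scalerBr opprD addrACA.
  - move=> v; rewrite (le_trans (nmB _ _))// mulrDl lerD//.
      by rewrite mulrC; exact: rep_contractive.
    rewrite (le_trans (rep_contractive r _ _))// -mulrA ler_wpM2l ?cnorm_ge0//.
    by rewrite mulrC; exact: rep_contractive.
  - by move=> p; rewrite lrC0 subrr.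
exists (mkBimod l1 r1 lrC), tau; split=> //= b d x y.
  by rewrite lE lQE lPE.
by rewrite rE rQE rPE.
Qed.
End TensorBimodule.

(** * Central vectors and part (c) *)

Arguments central {R E} H _.
Arguments Vset {R E} H Q beta _.

Section Central.
Variables (R : realType) (E : cstarType R) (H : hilbertBimod E).
Implicit Types (x y : H) (a b : E).

Lemma adE a x : ad a x = lact H a x - ract H a x. Proof. by []. Qed.

Lemma ad_linearr (k : R[i]) a x y : ad a (k *: x + y) = k *: ad a x + ad a y.
Proof. by rewrite !adE !linearP scalerDr addrACA. Qed.

Lemma ad_linearl (k : R[i]) a b x : ad (k *: a + b) x = k *: ad a x + ad b x.
Proof.
rewrite !adE [lact _ _ _]rep_linear [ract _ _ _](rep_linear (ract H) k a b).
by rewrite scalerBr opprD addrACA.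
Qed.

Lemma ad0r a : ad a (0 : H) = 0.
Proof. by rewrite adE !linear0 addr0. Qed.

Lemma adBr a x y : ad a (x - y) = ad a x - ad a y.
Proof. by rewrite addrC -scaleN1r ad_linearr scaleN1r addrC. Qed.

Lemma adBl a b x : ad (a - b) x = ad a x - ad b x.
Proof. by rewrite addrC -scaleN1r ad_linearl scaleN1r addrC. Qed.

Lemma ad_bound a x : nm (ad a x) <= 2 * cnorm a * nm x.
Proof.
rewrite adE (le_trans (nmB _ _))//.
have h1 := rep_contractive (lact H) a x.
have h2 : nm (ract H a x) <= cnorm a * nm x := rep_contractive (ract H) a x.
lra.
Qed.

Lemma central0 : central H 0. Proof. by move=> a; rewrite ad0r. Qed.

Lemma central_linear (k : R[i]) x y :
  central H x -> central H y -> central H (k *: x + y).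
Proof. by move=> cx cy a; rewrite ad_linearr cx cy scaler0 addr0. Qed.

Lemma centralZ (k : R[i]) x : central H x -> central H (k *: x).
Proof. by move=> cx; rewrite -[_ *: _]addr0; apply: central_linear => //; exact: central0. Qed.

Lemma central_approx x :
  (forall e : R, 0 < e -> exists2 y, central H y & nm (x - y) < e) -> central H x.
Proof.
move=> cx a; apply: nm_le0.
apply: ler_eps => e e0; rewrite add0r.
have a1 : 0 < 2 * cnorm a + 1 by rewrite ltr_wpDl// mulr_ge0// cnorm_ge0.
have [y cy xy] := cx _ (divr_gt0 e0 a1).
have -> : ad a x = ad a (x - y) by rewrite adBr cy subr0.
rewrite (le_trans (ad_bound _ _))//; rewrite ltr_pdivlMr// mulrC in xy.
by rewrite (le_trans _ (ltW xy))// ler_wpM2r ?nm_ge0// lerDl.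
Qed.

Lemma central_projP x : central H (central_proj x) /\
  forall y, central H y -> ip (x - central_proj x) y = 0.
Proof.
pose S := [set p | central H p /\ forall y, central H y -> inner (x - p) y = 0].
(* The long argument supplies closedness of the central vectors: a limit of central vectors is
   approximated by them. *)
have [p cp px] := @projection_theorem R H (central H) x central0 central_linear
  (fun u y cu uy => central_approx (fun e e0 =>
     let: ex_intro N HN := uy e e0 in
     ex_intro2 _ _ (u N) (cu N) (eq_ind _ (fun r => r < e) (HN N (leqnn N)) _ (nmBC _ _)))).
have Sp : S p by [].
exact: (@xgetPex _ 0 S (ex_intro _ p Sp)).
Qed.

(** Pythagoras. Strong property (T) can thus be verified by exhibiting any central vector near
    [x]. *)
Lemma central_proj_min x y : central H y -> nm (x - central_proj x) <= nm (x - y).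
Proof.
move=> cy; have [cp op] := central_projP x.
rewrite -(@ler_pXn2r _ 2)// ?nnegrE ?nm_ge0//.
have -> : x - y = (x - central_proj x) + (central_proj x - y).
  by rewrite addrA subrK.
rewrite [leRHS]sqr_nmD op ?mulr0 ?addr0; last first.
  by rewrite addrC -scaleN1r; exact: central_linear.
by rewrite lerDl sqr_ge0.
Qed.

Lemma central_neq0P : central H <> [set 0] <-> exists2 x, central H x & x != 0.
Proof.
split=> [h|[x cx x0] e]; last by move: cx; rewrite e => /eqP; apply/negP.
apply: contrapT => h'; apply: h; apply/seteqP; split=> x.
  move=> cx; apply/eqP; apply: contraT => x0; exfalso; apply: h'.
  by exists x.
by move=> ->; exact: central0.
Qed.

Lemma VsetP (Q : set E) (beta : R) x : Vset H Q beta x <->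
  nm x = 1 /\ forall a, Q a -> nm (ad a x) < beta.
Proof.
rewrite /Vset/=; split=> -[h1 h2]; split.
- by rewrite /nm h1.
- by move=> a /h2; rewrite ltr_normC.
- by rewrite nmE h1.
- by move=> a /h2; rewrite ltr_normC.
Qed.
End Central.

(** On an elementary tensor the two factors are moved from left to right one at a time; density does
    the rest. *)
Lemma central_generated (R : realType) (B D A : cstarType R)
  (N : seq (B * D) -> \bar R) (iB : {lrmorphism B -> A}) (iD : {lrmorphism D -> A})
  (H : hilbertBimod A) (x : H) : tensor_completion N iB iD ->
  (forall b, ad (iB b) x = 0) -> (forall d, ad (iD d) x = 0) -> central H x.
Proof.
move=> hA cB cD a; pose F (a : A) := ad a x.
apply: (@dense_eq0 R A (@cnorm R A) _ _ (@tensor_dense _ _ _ _ _ _ _ hA) H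
  (@nm R H) F (2 * nm x)).
- exact: nm_le0.
- by rewrite mulr_ge0// nm_ge0.
- by move=> k u v; exact: ad_linearl.
- by move=> v; rewrite mulrAC; exact: ad_bound.
- move=> [b d]; rewrite /F /elem/= adE repM.
  have /eqP := cD d; rewrite adE subr_eq0 => /eqP ->.
  have /eqP := cB b; rewrite adE subr_eq0 lactrC => /eqP ->.
  have -> : ract H (iB b * iD d) x = ract H (iD d) (ract H (iB b) x).
    exact: (repM (ract H) (iD d) (iB b) x).
  by rewrite subrr.
Qed.

Section Restriction.
Variables (R : realType) (E A : cstarType R) (j : {lrmorphism E -> A}).
Hypothesis jS : forall a, j (star a) = star (j a).

Definition restrict_rep (H : hilbertType R) (pi : starRep A H) : starRep E H.
Proof.
apply: (@StarRep R E H (fun a => pi (j a))).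
- by move=> a; exact: rep_bounded.
- by move=> k a b x; rewrite linearP rep_linear.
- by move=> a b x; rewrite rmorphM repM.
- by move=> a x y; rewrite jS; exact: rep_star.
Defined.

Lemma restrict_repE (H : hilbertType R) (pi : starRep A H) a x :
  restrict_rep pi a x = pi (j a) x.
Proof. by []. Qed.
End Restriction.

Definition restrict_bimod (R : realType) (E A : cstarType R) (j : {lrmorphism E -> A})
  (jS : forall a, j (star a) = star (j a)) (H : hilbertBimod A) : hilbertBimod E.
Proof.
apply: (@mkBimod R E H (restrict_rep jS (lact H))
   (@restrict_rep R (E^c)%type (A^c)%type (op_morphism j) jS H (ract H))).
- by move=> x; rewrite restrict_repE rmorph1 lact1.
- by move=> x; rewrite restrict_repE rmorph1 ract1.
- by move=> a b x; exact: lactrC.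
Defined.

Lemma almost_central_list (R : realType) (D : cstarType R) (K : hilbertBimod D)
  (J : Type) (le : J -> J -> Prop) (eta : J -> K) (s : seq D) (e : R) :
  almost_central_unit_vector le eta -> 0 < e ->
  exists y : K, nm y = 1 /\ forall d, d \in s -> nm (ad d y) < e.
Proof.
case=> -[[j0] le_refl tr dir] eta1 etac e0.
have [i0 Hi0] : exists i0, forall i, le i0 i -> forall d, d \in s -> nm (ad d (eta i)) < e.
  elim: s => [|d s [i1 H1]]; first by exists j0.
  have [i2 H2] := etac d e e0; have [i3 [i13 i23]] := dir i1 i2.
  exists i3 => i' i3i' d'; rewrite inE => /orP[/eqP->|].
    by rewrite -ltr_normC; apply: H2; exact: tr i3i'.
  by apply: H1; exact: tr i3i'.
exists (eta i0); split; first by rewrite /nm eta1.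
exact: Hi0.
Qed.

(** It lets a single constant serve the approximations of all elements of a finite set. *)
Lemma sum_flatten_ge (R : realType) (I : eqType) (T : Type) (f : I -> seq T) (g : T -> R)
  (s : seq I) a : (forall t, 0 <= g t) -> a \in s ->
  \sum_(p <- f a) g p <= \sum_(p <- flatten (map f s)) g p.
Proof.
move=> g0; elim: s => // b s IH; rewrite inE /= big_cat => /orP[/eqP ->|/IH h].
  by rewrite lerDl sumr_ge0.
by rewrite (le_trans h)// lerDr sumr_ge0.
Qed.

Section TensorTransfer.
Variables (R : realType) (B D A : cstarType R).
Variables (jB : {lrmorphism B -> A}) (jD : {lrmorphism D -> A}).
Hypothesis hA : min_tensor jB jD.

(** Shared by both versions of (c): the strong one uses [S], the other the last clause. One vector
    of the net, chosen from [F] and [eps] before [H] is given, is enough, so [Q] and [beta] are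
    uniform in [H]. *)
Lemma tensor_transfer (F : set A) (eps : R) :
  has_almost_central_unit_vector D -> finite_set F -> 0 < eps ->
  exists (Q : set B) (beta : R), [/\ finite_set Q, Q !=set0, 0 < beta &
    forall (H : hilbertBimod B) (x : H), Vset H Q beta x ->
    exists (L : hilbertBimod A) (u : L) (S : {linear L -> H}),
      [/\ Vset L F eps u, S u = x, forall v, nm (S v) <= nm v,
          forall v, central L v -> central H (S v) &
          (exists2 v, central L v & v != 0) -> exists2 w, central H w & w != 0]].
Proof.
move=> [K [J [le [eta eta_ac]]]] /finite_seqP[s ->] eps0.
(* Since [ad] has norm at most twice that of the element, this approximation costs [eps / 4]. *)
have /choice[t tP] a : exists t, cnorm (a - ev (elem jB jD) t) < eps / 8.
  by apply: (tensor_dense hA); lra.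
pose T := flatten [seq t a | a <- s].
pose g (p : R[i] * (B * D)) := nm p.1 * (cnorm p.2.1 + cnorm p.2.2).
have g0 p : 0 <= g p by rewrite mulr_ge0 ?addr_ge0 ?nm_ge0 ?cnorm_ge0.
pose M := \sum_(p <- T) g p + 1.
have M0 : 0 < M by rewrite ltr_wpDl// sumr_ge0.
(* The contribution of the elementary tensors is at most [M * beta], a second [eps / 4]. *)
pose beta := eps / (4 * M).
have beta0 : 0 < beta by rewrite divr_gt0// mulr_gt0.
have Mbeta : M * beta = eps / 4 by rewrite /beta; field; rewrite gt_eqF.
have [y [y1 yD]] := almost_central_list [seq p.2.2 | p <- T] eta_ac beta0.
(* The entry 0 keeps the set non-empty even when no elementary tensor occurs. *)
exists [set` 0 :: [seq p.2.1 | p <- T]], beta; split=> //.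
- by apply/finite_seqP; exists (0 :: [seq p.2.1 | p <- T]).
- by exists 0; exact: mem_head.
move=> H x /VsetP[x1 xQ].
have [L [tau [htau lE rE]]] := tensor_bimod hA H K.
have dL := tens_dense htau.
have lB b v z : lact L (jB b) (tens tau (v, z)) = tens tau (lact H b v, z).
  by rewrite -[jB b]mulr1 -(rmorph1 jD) lE lact1.
have rB b v z : ract L (jB b) (tens tau (v, z)) = tens tau (ract H b v, z).
  by rewrite -[jB b]mulr1 -(rmorph1 jD) rE ract1.
have Sad z b v : slice htau z (ad (jB b) v) = ad b (slice htau z v).
  rewrite !adE linearB; congr (_ - _).
    exact: (@slice_rep R H K L tau htau z B (lact H)
      (restrict_rep (tensor_starB hA) (lact L)) b v lB).
  exact: (@slice_rep R H K L tau htau z (B^c)%type (ract H)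
    (@restrict_rep R (B^c)%type (A^c)%type (op_morphism jB) (tensor_starB hA) L (ract L))
    b v rB).
have Scen z v : central L v -> central H (slice htau z v).
  by move=> cv b; rewrite -Sad cv linear0.
pose u : L := tens tau (x, y).
have u1 : nm u = 1 by rewrite nm_tens// x1 y1 mulr1.
exists L, u, (slice htau y); split.
- apply/VsetP; split=> // a /= sa.
  have -> : ad a u = ad (a - ev (elem jB jD) (t a)) u + ad (ev (elem jB jD) (t a)) u.
    by rewrite adBl subrK.
  have h1 := ad_bound (a - ev (elem jB jD) (t a)) u; rewrite u1 mulr1 in h1.
  have h2 : nm (ad (ev (elem jB jD) (t a)) u) <= M * beta.
    have adl : linear (fun a => @ad R A L a u) by move=> k b c; exact: ad_linearl.
    rewrite [ad _ u](ev_linear _ _ adl) (le_trans (nm_sum _ _))//.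
    apply: (@le_trans _ _ (\sum_(p <- t a) g p * beta)).
      rewrite big_seq [leRHS]big_seq; apply: ler_sum => -[k [b d]] pT /=.
      rewrite nmZ /g -mulrA ler_wpM2l ?nm_ge0//= mulrDl.
      have pT' : (k, (b, d)) \in T.
        by apply/flattenP; exists (t a) => //; apply: map_f.
      have xb : nm (ad b x) < beta.
        by apply: xQ; apply: (@mem_behead _ (0 :: [seq p.2.1 | p <- T])); apply/mapP; exists (k, (b, d)).
      have yd : nm (ad d y) < beta by apply: yD; apply/mapP; exists (k, (b, d)).
      (* A Leibniz rule: each summand contains one small commutator, of [b] with [x] or of [d] with
         [y]. *)
      have -> : ad (elem jB jD (b, d)) u =
          tens tau (ad b x, lact K d y) + tens tau (ract H b x, ad d y).
        rewrite adE /elem/= lE rE /u !adE tensBl tensBr addrA subrK //.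
      rewrite (le_trans (nmD _ _))// !nm_tens//= addrC lerD//.
        rewrite ler_pM ?nm_ge0 ?(ltW yd)//.
        have h : nm (ract H b x) <= cnorm b * nm x := rep_contractive (ract H) b x.
        by rewrite x1 mulr1 in h.
      rewrite mulrC ler_pM ?nm_ge0 ?(ltW xb)//.
      by have := rep_contractive (lact K) d y; rewrite y1 mulr1.
    rewrite -mulr_suml ler_wpM2r ?(ltW beta0)//.
    by rewrite (le_trans (sum_flatten_ge t g0 sa))// lerDl.
  have h3 := nmD (ad (a - ev (elem jB jD) (t a)) u) (ad (ev (elem jB jD) (t a)) u).
  have h4 := tP a; rewrite Mbeta in h2.
  rewrite (le_lt_trans h3)//; lra.
- by rewrite /u sliceE/= ipxx y1 expr1n scale1r.
- by move=> v; rewrite (le_trans (slice_bound htau y v))// y1 mul1r.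
- exact: Scen.
- move=> [v cv v0]; apply: contrapT => h; move/eqP: v0; apply.
  apply: (@slice_eq0 R H K L tau htau v) => z; apply: contrapT => /eqP sz; apply: h.
  by exists (slice htau z v) => //; exact: Scen.
Qed.

Lemma propertyT_min_left : has_almost_central_unit_vector D ->
  propertyT A -> propertyT B.
Proof.
move=> ac [F [eps [Ff F0 eps0 FT]]].
have [Q [beta [Qf Q0 beta0 QT]]] := tensor_transfer ac Ff eps0.
exists Q, beta; split=> // H [x xV].
have [L [u [S [uV _ _ _ cen]]]] := QT H x xV.
by apply/central_neq0P/cen/central_neq0P/FT; exists u.
Qed.

Lemma strong_propertyT_min_left : has_almost_central_unit_vector D ->
  strong_propertyT A -> strong_propertyT B.
Proof.
move=> ac sT alpha alpha0; have [F [eps [Ff F0 eps0 FT]]] := sT alpha alpha0.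
have [Q [beta [Qf Q0 beta0 QT]]] := tensor_transfer ac Ff eps0.
exists Q, beta; split=> // H x xV.
have [L [u [S [uV Su Sle cen _]]]] := QT H x xV.
have := FT L u uV; rewrite !ltr_normC; apply: le_lt_trans.
have [cp _] := central_projP u.
rewrite (le_trans (central_proj_min x (cen _ cp)))//.
by rewrite -{1}Su -linearB Sle.
Qed.
End TensorTransfer.

(** * Part (a) *)

Section FixedBimodule.
Variables (R : realType) (B D A : cstarType R) (N : seq (B * D) -> \bar R).
Variables (iB : {lrmorphism B -> A}) (iD : {lrmorphism D -> A}).
Hypothesis hA : tensor_completion N iB iD.

(* K is the space of B-central vectors of H. *)
Lemma fixed_bimod (H : hilbertBimod A) :
  exists (K : hilbertBimod D) (W : {linear K -> H}),
  [/\ forall v, nm (W v) = nm v,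
      forall d v, W (ad d v) = ad (iD d) (W v),
      forall b v, ad (iB b) (W v) = 0 &
      forall x, (forall b, ad (iB b) x = 0) -> exists v, W v = x].
Proof.
pose X := {x : H | forall b, ad (iB b) x = 0}.
have [K [phi [phiE dK]]] := kolmogorov (map_kernel (fun x : X => sval x)).
have lstab (x : X) d b : ad (iB b) (lact H (iD d) (sval x)) = 0.
  have cx := svalP x b; rewrite adE in cx.
  have e : lact H (iB b) (sval x) = ract H (iB b) (sval x).
    by apply/eqP; rewrite -subr_eq0 cx.
  by rewrite adE -repM (tensor_comm hA) repM e lactrC subrr.
have rstab (x : X) d b : ad (iB b) (ract H (iD d) (sval x)) = 0.
  have cx := svalP x b; rewrite adE in cx.
  have e : lact H (iB b) (sval x) = ract H (iB b) (sval x).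
    by apply/eqP; rewrite -subr_eq0 cx.
  rewrite adE lactrC e.
  have -> : ract H (iD d) (ract H (iB b) (sval x)) = ract H (iB b * iD d) (sval x).
    exact: esym (repM (ract H) (iD d) (iB b) (sval x)).
  have -> : ract H (iB b) (ract H (iD d) (sval x)) = ract H (iD d * iB b) (sval x).
    exact: esym (repM (ract H) (iB b) (iD d) (sval x)).
  by rewrite (tensor_comm hA) subrr.
have phi_lin (k : R[i]) (x y z : X) : sval z = k *: sval x + sval y ->
    phi z = k *: phi x + phi y.
  move=> e; apply: (dense_ip_eq dK) => w.
  by rewrite ipDl ipZl !phiE /= e ipDl ipZl.
have [l lE] : exists l : starRep D K, forall d x, l d (phi x) = phi (exist _ _ (lstab x d)).
  apply: (@rep_on_family R D K X phi (fun d x => exist _ _ (lstab x d)) dK).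
  - by move=> d x y; rewrite !phiE /= rep_ip (tensor_starD hA).
  - by move=> k d d' x; apply: phi_lin; rewrite /= linearP rep_linear.
  - move=> d d' x; congr phi; apply: eq_exist => /=.
    by rewrite rmorphM repM.
have [r rE] : exists r : starRep (D^c)%type K,
    forall d x, r d (phi x) = phi (exist _ _ (rstab x d)).
  apply: (@rep_on_family R (D^c)%type K X phi (fun d x => exist _ _ (rstab x d)) dK).
  - move=> d x y; rewrite !phiE /=.
    by rewrite [LHS](rep_ip (ract H) (iD d)) -[star _]/(star (iD d : A)) -(tensor_starD hA).
  - move=> k d d' x; apply: phi_lin; rewrite /= [iD _](linearP iD k d d').
    exact: (rep_linear (ract H) k (iD d) (iD d') (sval x)).
  - move=> d d' x; congr phi; apply: eq_exist => /=.
    rewrite [iD _](rmorphM iD d' d); exact: (repM (ract H) (iD d) (iD d')).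
have l1 : forall x, l 1 x = x.
  apply: (rep1_ext dK) => x; rewrite lE; congr phi; case: x => x cx.
  by apply: eq_exist; rewrite /= rmorph1 lact1.
have r1 : forall x, r 1 x = x.
  apply: (rep1_ext dK) => x; rewrite rE; congr phi; case: x => x cx.
  by apply: eq_exist; rewrite /= rmorph1 ract1.
have lrC a b x : l a (r b x) = r b (l a x).
  apply: (rep_ext dK) => {}x; rewrite rE !lE rE; congr phi; apply: eq_exist => /=.
  by rewrite lactrC.
have phin t : nm (ev (fun x : X => sval x) t) = nm (ev phi t).
  have : nm (ev (fun x : X => sval x) t) ^+ 2 = nm (ev phi t) ^+ 2.
    rewrite -!Re_ipxx; congr complex.Re; rewrite !ip_evl.
    apply: eq_bigr => p _; congr (_ * _); rewrite !ip_evr.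
    by apply: eq_bigr => q _; rewrite phiE.
  by move=> /eqP; rewrite eqrXn2 ?nm_ge0// => /eqP.
(* [W] is the inclusion of the B-central vectors into [H], extended from the points of [X]. *)
have [|t|W W1 W2] := @extension R K (@nm R K) (@nmD R K) (@nmZ R K) X phi dK H
  (fun x : X => sval x) 1.
- by [].
- by rewrite phin mul1r.
have W3 v : nm (W v) <= nm v by have := W2 v; rewrite mul1r.
exists (mkBimod l1 r1 lrC), W; split.
- move=> v; apply/eqP; rewrite eq_le W3 /=; apply: ler_eps => e e0.
  have [t ht] := dK v (e / 2) ltac:(by rewrite divr_gt0).
  have Wt : W (ev phi t) = ev (fun x : X => sval x) t.
    by rewrite (ev_linear _ _ (linearP W)); apply: eq_ev => x /=; rewrite W1.
  have h1 := nm_lerB v (ev phi t); rewrite -phin -Wt in h1.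
  have h2 := nm_lerB (W (ev phi t)) (W v); rewrite -(linearB W) in h2.
  have h3 := W3 (ev phi t - v); rewrite (nmBC _ v) in h3; lra.
- move=> d v; rewrite !adE linearB /=; congr (_ - _).
    apply: (@dense_ext R K X phi dK H (fun v => W (l d v))
      (fun v => lact H (iD d) (W v)) (cnorm d) (cnorm (iD d))).
    + exact: cnorm_ge0.
    + exact: cnorm_ge0.
    + by move=> k u w; rewrite !linearP.
    + by move=> k u w; rewrite !linearP.
    + by move=> w; rewrite (le_trans (W3 _))// rep_contractive.
    + by move=> w; rewrite (le_trans (rep_contractive _ _ _))// ler_wpM2l ?cnorm_ge0.
    + by move=> x; rewrite lE !W1.
  apply: (@dense_ext R K X phi dK H (fun v => W (r d v))
    (fun v => ract H (iD d) (W v)) (cnorm d) (cnorm (iD d))).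
  + exact: cnorm_ge0.
  + exact: cnorm_ge0.
  + by move=> k u w; rewrite !linearP.
  + by move=> k u w; rewrite !linearP.
  + by move=> w; rewrite (le_trans (W3 _))//; exact: (rep_contractive r).
  + move=> w; apply: le_trans (rep_contractive (ract H) _ _) _.
    by rewrite ler_wpM2l ?cnorm_ge0.
  + by move=> x; rewrite rE !W1.
- move=> b v; apply: (@dense_ext R K X phi dK H (fun v => ad (iB b) (W v))
    (fun v => 0) (2 * cnorm (iB b)) 0) => //.
  + by rewrite mulr_ge0 ?cnorm_ge0.
  + by move=> k u w; rewrite linearP ad_linearr.
  + by move=> k u w; rewrite scaler0 addr0.
  + move=> w; rewrite (le_trans (ad_bound _ _))// ler_wpM2l ?W3//.
    by rewrite mulr_ge0 ?cnorm_ge0.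
  + by move=> w; rewrite nm0 mul0r.
  + by move=> x; rewrite W1 (svalP x).
- by move=> x cx; exists (phi (exist _ x cx)); rewrite W1.
Qed.

(** [c *: W u] is the projection of [x] onto the B-central vectors and [u] its normalisation in the
    D-bimodule. Being close to [x], the projection is non-zero and inherits almost commutation with
    [D]. *)
Lemma fixed_transfer (F : set D) (eps delta : R) :
  strong_propertyT B -> finite_set F -> 0 < eps -> 0 < delta ->
  exists (Q : set A) (beta : R), [/\ finite_set Q, Q !=set0, 0 < beta &
    forall (H : hilbertBimod A) (x : H), Vset H Q beta x ->
    exists (K : hilbertBimod D) (W : {linear K -> H}) (u : K) (c : R[i]),
      [/\ Vset K F eps u, nm c <= 2 /\ nm (x - c *: W u) < delta,
          forall v, nm (W v) = nm v &
          forall v, central K v -> central H (W v)]].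
Proof.
move=> sB /finite_seqP[s ->] eps0 delta0.
pose m := \sum_(d <- s) cnorm (iD d).
have m0 : 0 <= m by apply: sumr_ge0 => d _; exact: cnorm_ge0.
have ms d : d \in s -> cnorm (iD d) <= m.
  move=> ds; rewrite /m (big_rem d ds) /= lerDl.
  by apply: sumr_ge0 => ? _; exact: cnorm_ge0.
have m1 : 0 < 16 * (m + 1) by rewrite mulr_gt0// ltr_wpDl.
(* The bound 1/2 keeps the projection [y] at norm above 1/2. The last bound makes the commutators of
   x - y with [F] at most [eps / 8]; together with [beta] they stay below [eps / 4], leaving room
   for the division by |y|. *)
pose alpha := Num.min (1 / 2) (Num.min delta (eps / (16 * (m + 1)))).
have alpha0 : 0 < alpha by rewrite !lt_min delta0 !divr_gt0.
have a1 : alpha <= 1 / 2 by rewrite /alpha ge_min lexx.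
have a2 : alpha <= delta by rewrite /alpha !ge_min lexx !orbT.
have a3 : alpha * (16 * (m + 1)) <= eps.
  by rewrite -ler_pdivlMr// /alpha !ge_min lexx !orbT.
have [Qb [betab [Qf [q0 Qq0] betab0 QT]]] := sB alpha alpha0.
pose beta := Num.min betab (eps / 8).
have beta0 : 0 < beta by rewrite lt_min betab0 divr_gt0.
have b1 : beta <= betab by rewrite /beta ge_min lexx.
have b2 : beta <= eps / 8 by rewrite /beta ge_min lexx orbT.
exists ((iB @` Qb) `|` (iD @` [set` s])), beta; split=> //.
- by rewrite finite_setU; split; apply: finite_image => //; exact: finite_seq.
- by exists (iB q0); left; exists q0.
move=> H x /VsetP[x1 xQ].
pose HB := restrict_bimod (tensor_starB hA) H.
pose y : H := @central_proj R B HB x.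
have [cy _] := @central_projP R B HB x.
have xy : nm (x - y) < alpha.
  rewrite -ltr_normC; apply: (QT HB x); apply/VsetP; split=> // b Qb'.
  by apply: lt_le_trans b1; apply: xQ; left; exists b.
have y1 := nm_lerB x y; have y2 := nm_lerB y x; rewrite nmBC in y2.
have ny0 : 0 < nm y by lra.
have [K [W [Wn Wad WB Wsurj]]] := fixed_bimod H.
have [v Wv] := Wsurj y cy.
pose u := (nm y)^-1%:C *: v.
have Wu : W u = (nm y)^-1%:C *: y by rewrite /u linearZ/= Wv.
have nV : nm ((nm y)^-1%:C : R[i]) = (nm y)^-1.
  by rewrite nm_real ger0_norm// invr_ge0 ltW.
exists K, W, u, (nm y)%:C; split=> //.
- apply/VsetP; split.
    by rewrite /u nmZ nV -Wn Wv mulVf// gt_eqF.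
  move=> d ds; rewrite -Wn Wad Wu.
  have -> : ad (iD d) ((nm y)^-1%:C *: y) = (nm y)^-1%:C *: ad (iD d) y.
    by rewrite -[_ *: y]addr0 ad_linearr ad0r addr0.
  rewrite nmZ nV mulrC ltr_pdivrMr//.
  have -> : ad (iD d) y = ad (iD d) x - ad (iD d) (x - y) by rewrite adBr opprB addrC subrK.
  rewrite (le_lt_trans (nmB _ _))//.
  have h1 : nm (ad (iD d) x) < beta by apply: xQ; right; exists d.
  have h2 := ad_bound (iD d) (x - y).
  have h3 : cnorm (iD d) * nm (x - y) <= m * alpha.
    by rewrite ler_pM ?cnorm_ge0 ?nm_ge0 ?(ltW xy)//; exact: ms.
  have h4 : eps * (1 / 2) <= eps * nm y by rewrite ler_wpM2l ?(ltW eps0)//; lra.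
  lra.
- split; first by rewrite nm_real ger0_norm ?(ltW ny0)//; lra.
  rewrite Wu scalerA -rmorphM mulfV ?gt_eqF// rmorph1 scale1r.
  exact: lt_le_trans a2.
- move=> w cw; apply: (central_generated hA) => [b|d]; first exact: WB.
  by rewrite -Wad cw linear0.
Qed.

Lemma propertyT_max : strong_propertyT B -> propertyT D -> propertyT A.
Proof.
move=> sB [F [eps [Ff _ eps0 FT]]].
have [Q [beta [Qf Q0 beta0 QT]]] := fixed_transfer sB Ff eps0 ltr01.
exists Q, beta; split=> // H [x xV].
have [K [W [u [c [uV _ Wn Wc]]]]] := QT H x xV.
have /central_neq0P[v cv v0] : central K <> [set 0] by apply: FT; exists u.
apply/central_neq0P; exists (W v); first exact: Wc.
by apply: contra_neq v0 => Wv; apply: nm_eq0; rewrite -Wn Wv nm0.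
Qed.

Lemma strong_propertyT_max :
  strong_propertyT B -> strong_propertyT D -> strong_propertyT A.
Proof.
(* The first error is below [alpha / 4], and the second, scaled by |c| <= 2, is at most
   [alpha / 2]. *)
move=> sB sD alpha alpha0; have a4 : 0 < alpha / 4 by rewrite divr_gt0.
have [F [eps [Ff _ eps0 FT]]] := sD _ a4.
have [Q [beta [Qf Q0 beta0 QT]]] := fixed_transfer sB Ff eps0 a4.
exists Q, beta; split=> // H x xV.
have [K [W [u [c [uV [c2 xc] Wn Wc]]]]] := QT H x xV.
have := FT K u uV; rewrite !ltr_normC => h.
have [cp _] := central_projP u.
rewrite (le_lt_trans (central_proj_min x (centralZ c (Wc _ cp))))//.
rewrite (le_lt_trans (nm_dist (c *: W u) _ _))//.
rewrite -scalerBr -linearB nmZ Wn.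
have := ler_pM (nm_ge0 c) (nm_ge0 _) c2 (ltW h); lra.
Qed.
End FixedBimodule.

(** * Direct sums and parts (b) and (d) *)

Section DirectSum.
Variables (R : realType) (I : eqType) (K : I -> hilbertType R).

(** The summands are different types, so the index equality is decided and its proof transports the
    vector; all other coordinates are 0. *)
Definition component (p : {i : I & K i}) (j : I) : K j :=
  match projT1 p =P j with
  | ReflectT e => eq_rect (projT1 p) (fun i => K i : Type) (projT2 p) j e
  | ReflectF _ => 0
  end.

Lemma componentE i (x : K i) : component (existT _ i x) i = x.
Proof.
rewrite /component; case: eqP => //= e.
by rewrite (eq_axiomK e).
Qed.

Lemma component0 p j : projT1 p != j -> component p j = 0.
Proof. by rewrite /component; case: eqP. Qed.

Definition dsum_ker (p q : {i : I & K i}) : R[i] :=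
  ip (component p (projT1 q)) (projT2 q).

Lemma dsum_ker0 p q : projT1 p != projT1 q -> dsum_ker p q = 0.
Proof. by move=> pq; rewrite /dsum_ker component0// ip0l. Qed.

Lemma dsum_kerE i (x y : K i) : dsum_ker (existT _ i x) (existT _ i y) = ip x y.
Proof. by rewrite /dsum_ker componentE. Qed.

Lemma dsum_kerC p q : dsum_ker p q = Num.conj (dsum_ker q p).
Proof.
case: p q => [i x] [j y]; have [ij|ij] := eqVneq i j.
  by subst j; rewrite !dsum_kerE ipC.
by rewrite !dsum_ker0 ?rmorph0//= eq_sym.
Qed.

Lemma dsum_ker_sum (U : seq I) p q : uniq U -> projT1 q \in U ->
  dsum_ker p q = \sum_(i <- U) ip (component p i) (component q i).
Proof.
move=> Uu qU; rewrite (bigD1_seq _ qU Uu) /= big1 => [|i iq].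
  by rewrite addr0; case: q qU => j y _ /=; rewrite componentE.
by rewrite (@component0 q) 1?eq_sym// ip0r.
Qed.

(** Only the finitely many indices in [U] occur in [t], and in each coordinate the form is the
    square of a norm. *)
Lemma dsum_kernel_pos t : 0 <= complex.Re (pairing (frep dsum_ker t) t).
Proof.
pose U := undup [seq projT1 p.2 | p <- t].
have -> : pairing (frep dsum_ker t) t =
    \sum_(i <- U) ip (ev (component^~ i) t) (ev (component^~ i) t).
  transitivity (\sum_(q <- t) \sum_(i <- U)
      Num.conj q.1 * \sum_(p <- t) p.1 * ip (component p.2 i) (component q.2 i)).
    have : all (fun q => projT1 q.2 \in U) t.
      rewrite -(all_map (fun q : R[i] * _ => projT1 q.2) (fun i => i \in U)).
      by apply/allP => i; rewrite mem_undup.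
    (* The outer sum is generalised to [s], because induction on [t] itself would also change the
       inner sums. *)
    suff key s : all (fun q => projT1 q.2 \in U) s ->
        \sum_(q <- s) Num.conj q.1 * frep dsum_ker t q.2 =
        \sum_(q <- s) \sum_(i <- U)
        Num.conj q.1 * \sum_(p <- t) p.1 * ip (component p.2 i) (component q.2 i).
      exact: key.
    elim: s => [|q s IH] /=; first by rewrite !big_nil.
    move=> /andP[qU /IH {}IH]; rewrite !big_cons IH; congr (_ + _).
    rewrite -mulr_sumr exchange_big; congr (_ * _); apply: eq_bigr => p _ /=.
    by rewrite (dsum_ker_sum _ (undup_uniq _) qU) mulr_sumr.
  rewrite exchange_big; apply: eq_bigr => i _ /=.
  rewrite ip_evr; apply: eq_bigr => q _; congr (_ * _).
  by rewrite ip_evl.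
elim: U => [|i U IH]; first by rewrite big_nil.
by rewrite big_cons ReD addr_ge0// Re_ipxx sqr_ge0.
Qed.

Definition dsum_kernel : kernel R {i : I & K i} := Kernel dsum_kerC dsum_kernel_pos.

Lemma component_rep (E : cstarType R) (pi : forall i, starRep E (K i)) a p j :
  component (existT _ (projT1 p) (pi (projT1 p) a (projT2 p))) j =
  pi j a (component p j).
Proof.
case: p => i x /=; have [ij|ij] := eqVneq i j; first by subst j; rewrite !componentE.
by rewrite !component0//= linear0.
Qed.

Variables (L : hilbertType R) (phi : {i : I & K i} -> L).
Hypothesis phiE : forall p q, ip (phi p) (phi q) = dsum_kernel p q.
Hypothesis phid : forall v (e : R), 0 < e -> exists t, nm (v - ev phi t) < e.

Lemma dsum_linear i (k : R[i]) (x y : K i) :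
  phi (existT _ i (k *: x + y)) = k *: phi (existT _ i x) + phi (existT _ i y).
Proof.
apply: (dense_ip_eq phid) => -[j z]; rewrite ipDl ipZl !phiE.
rewrite /= /dsum_ker /=; have [ij|ij] := eqVneq i j.
  by subst j; rewrite !componentE ipDl ipZl.
by rewrite !component0//= !ip0l mulr0 addr0.
Qed.

Lemma dsum_rep (E : cstarType R) (pi : forall i, starRep E (K i)) :
  exists P : starRep E L, forall a i x,
    P a (phi (existT _ i x)) = phi (existT _ i (pi i a x)).
Proof.
pose alpha a (p : {i : I & K i}) := existT (fun i => K i : Type) (projT1 p)
  (pi (projT1 p) a (projT2 p)).
have [|k a b p|a b p|P PE] := @rep_on_family R E L _ phi alpha phid.
- move=> a p q; rewrite !phiE /= /dsum_ker /= component_rep rep_ip //.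
- by rewrite /alpha rep_linear dsum_linear; case: p.
- by rewrite /alpha repM.
by exists P => a i x; rewrite PE.
Qed.

Lemma nm_dsum i (x : K i) : nm (phi (existT _ i x)) = nm x.
Proof.
have : nm (phi (existT _ i x)) ^+ 2 = nm x ^+ 2.
  by rewrite -!Re_ipxx phiE /= dsum_kerE.
by move=> /eqP; rewrite eqrXn2 ?nm_ge0// => /eqP.
Qed.
End DirectSum.

Lemma dsum_bimod (R : realType) (E : cstarType R) (I : eqType) (K : I -> hilbertBimod E) :
  exists (L : hilbertBimod E) (phi : forall i, K i -> L),
    (forall i x, nm (phi i x) = nm x) /\
    (forall i a x, ad a (phi i x) = phi i (ad a x)).
Proof.
have [L [phi [phiE phid]]] := kolmogorov (dsum_kernel (fun i => K i : hilbertType R)).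
have [l lE] := dsum_rep phiE phid (fun i => lact (K i)).
have [r rE] := dsum_rep phiE phid (fun i => ract (K i)).
have l1 : forall x, l 1 x = x.
  by apply: (rep1_ext phid) => -[i x]; rewrite lE lact1.
have r1 : forall x, r 1 x = x.
  by apply: (rep1_ext phid) => -[i x]; rewrite rE ract1.
have lrC a b x : l a (r b x) = r b (l a x).
  by apply: (rep_ext phid) => -[i y]; rewrite rE !lE rE lactrC.
exists (mkBimod l1 r1 lrC), (fun i x => phi (existT _ i x)); split.
  by move=> i x; exact: nm_dsum.
move=> i a x; rewrite !adE /= lE rE.
have := dsum_linear phiE phid (-1) (ract (K i) a x) (lact (K i) a x).
by rewrite !scaleN1r [in RHS]addrC [in LHS]addrC => <-.
Qed.

Lemma no_almost_central (R : realType) (D : cstarType R) :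
  ~ has_almost_central_unit_vector D ->
  exists (Q : set D) (beta : R), [/\ finite_set Q, Q !=set0, 0 < beta &
    forall (H : hilbertBimod D) (x : H), ~ Vset H Q beta x].
Proof.
move=> noac; apply: contrapT => h; apply: noac.
(* A finite list and a precision 1/(n+1): each such pair is a candidate for [Q] and [beta], whose
   failure yields a vector. Inclusion of lists and the order of precisions direct the index set. *)
pose I := (seq D * nat)%type.
have ex (i : I) : exists H : hilbertBimod D, exists x : H,
    nm x = 1 /\ forall a, a \in i.1 -> nm (ad a x) < i.2.+1%:R^-1.
  apply: contrapT => h'; apply: h; exists [set` 0 :: i.1], (i.2.+1%:R^-1); split.
  - by apply/finite_seqP; exists (0 :: i.1).
  - by exists 0; exact: mem_head.
  - by rewrite invr_gt0.
  move=> H x /VsetP[x1 xQ]; apply: h'; exists H, x; split=> // a ai.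
  by apply: xQ; exact: mem_behead.
have /choice[K KP] := ex.
pose eta i : K i := sval (cid (KP i)).
have eta1 i : nm (eta i) = 1 := (svalP (cid (KP i))).1.
have etaP i : forall a, a \in i.1 -> nm (ad a (eta i)) < i.2.+1%:R^-1 :=
  (svalP (cid (KP i))).2.
have [L [phi [phin phiad]]] := dsum_bimod K.
exists L, I, (fun i j => {subset i.1 <= j.1} /\ (i.2 <= j.2)%N),
  (fun i => phi i (eta i)); split.
- split; first exact: (inhabits ([::], 0%N)).
  + by move=> i; split.
  + move=> i j k [ij1 ij2] [jk1 jk2]; split; last exact: leq_trans jk2.
    by move=> a /ij1/jk1.
  + move=> i j; exists (i.1 ++ j.1, maxn i.2 j.2); rewrite /= leq_maxl leq_maxr.
    by do 2?split=> //; move=> a ai; rewrite mem_cat ai ?orbT.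
- by move=> i; rewrite nmE phin eta1.
- move=> a e e0; have [N HN] := invS_lt e0; exists ([:: a], N) => i [ai Ni].
  rewrite ltr_normC phiad phin; apply: lt_trans (HN _ Ni).
  by apply: etaP; apply: ai; rewrite mem_head.
Qed.

(** Bimodules over [A] restrict along [j], so the sets [Vset] for the image of [Q] are empty and
    both properties hold vacuously. For (b) the morphism is the embedding of D, for (d) the identity
    of D. *)
Lemma strong_propertyT_no_almost_central (R : realType) (E A : cstarType R)
  (j : {lrmorphism E -> A}) : (forall a, j (star a) = star (j a)) ->
  ~ has_almost_central_unit_vector E -> propertyT A /\ strong_propertyT A.
Proof.
move=> jS /no_almost_central[Q [beta [Qf [q Qq] beta0 QV]]].
have noV (H : hilbertBimod A) x : ~ Vset H (j @` Q) beta x.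
  move=> /VsetP[x1 xQ]; apply: (QV (restrict_bimod jS H) x).
  by apply/VsetP; split=> // a Qa; apply: xQ; exists a.
have jQ0 : (j @` Q) !=set0 by exists (j q), q.
have jQf : finite_set (j @` Q) by exact: finite_image.
split; first by exists (j @` Q), beta; split=> // H [x /noV].
by move=> alpha _; exists (j @` Q), beta; split=> // H x /noV.
Qed.

Theorem theorem4p5 (R : realType) (B D A A0 : cstarType R)
  (iB : {lrmorphism B -> A}) (iD : {lrmorphism D -> A})
  (jB : {lrmorphism B -> A0}) (jD : {lrmorphism D -> A0})
  (hA : max_tensor iB iD) (hA0 : min_tensor jB jD) :
  ((strong_propertyT B -> propertyT D -> propertyT A) /\
   (strong_propertyT B -> strong_propertyT D -> strong_propertyT A)) /\
  (~ has_almost_central_unit_vector D -> strong_propertyT A) /\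
  (has_almost_central_unit_vector D ->
   (propertyT A0 -> propertyT B) /\
   (strong_propertyT A0 -> strong_propertyT B)) /\
  ((propertyT A0 -> propertyT B \/ propertyT D) /\
   (strong_propertyT A0 -> strong_propertyT B \/ strong_propertyT D)).
Proof.
split; first by split; [exact: propertyT_max hA|exact: strong_propertyT_max hA].
split.
  by move=> /(strong_propertyT_no_almost_central (tensor_starD hA))[].
have c ac := conj (propertyT_min_left hA0 ac) (strong_propertyT_min_left hA0 ac).
split; first exact: c.
have [/c[c1 c2]|noac] := pselect (has_almost_central_unit_vector D).
  by split=> [/c1|/c2]; left.
have [D1 D2] := @strong_propertyT_no_almost_central R D D idfun (fun=> erefl) noac.
by split=> _; right.
Qed.
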